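(* Let $G$ be a countable group with no finitely generated subgroup of exponential growth. Let $G\curvearrowright X$ be an action on a countable set $X$ which preserves a linear order (respectively, a circular order) on $X$. Then there exist an action $G\curvearrowright M$ on $M=[0,1]$ (respectively, $M=\mathbb{S}^1$) by $C^1$ diffeomorphisms and a $G$-equivariant, injective, order-preserving (respectively, circular-order-preserving) map $i\colon X\hookrightarrow M$.
   Context: A finitely generated group $H$ with finite symmetric generating set $S$ containing the identity has exponential growth if $\lim_{n\to\infty}|S^n|^{1/n}>1$, where $S^n=\{s_1\cdots s_n : s_j\in S\}$ (this does not depend on $S$); otherwise it has subexponential growth. A linear order is a total order. A circular (or cyclic) order on a set $X$ is a function $c\colon X\times X\times X\to\{0,1,-1\}$ such that for all $x_1,x_2,x_3,x_4\in X$: (1) $c(x_1,x_2,x_3)=0$ if and only if $x_i=x_j$ for some $i\neq j$; (2) $c(x_2,x_3,x_4)-c(x_1,x_3,x_4)+c(x_1,x_2,x_4)-c(x_1,x_2,x_3)=0$. A map $f\colon (X,c_X)\to (Y,c_Y)$ is circular-order-preserving if $c_Y(f(x_1),f(x_2),f(x_3))=c_X(x_1,x_2,x_3)$ for all $x_1,x_2,x_3\in X$. An action of $G$ on $X$ preserves a linear (respectively, circular) order if every element of $G$ acts by a linear-order-preserving (respectively, circular-order-preserving) transformation. The interval $[0,1]$ carries its usual linear order, and $\mathbb{S}^1=\mathbb{R}/\mathbb{Z}$ carries its standard circular order, where $c(x,y,z)=1$ if $x,y,z$ are distinct and positively (counterclockwise) ordered, and $c(x,y,z)=-1$ if they are distinct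 and negatively ordered. *)

(* Defs.v *)
From HB Require Import structures.
From mathcomp Require Import all_boot all_order all_algebra.
From mathcomp Require Import finmap.
From mathcomp Require Import all_classical all_reals all_analysis.
Import Order.TTheory GRing.Theory Num.Theory.
Import numFieldNormedType.Exports.

Set Implicit Arguments.
Unset Strict Implicit.
Unset Printing Implicit Defensive.

Local Open Scope classical_set_scope.
Local Open Scope ring_scope.

Definition is_subgroup (G : groupType) (H : set G) : Prop :=
  [/\ H 1%g,
      forall x y, H x -> H y -> H (x * y)%g
    & forall x, H x -> H (x^-1)%g].

Definition generated_subgroup (G : groupType) (S : set G) : set G :=
  smallest (@is_subgroup G) S.

Definition finitely_generated (G : groupType) (H : set G) : Prop :=
  exists S : {fset G}, generated_subgroup [set` S] = H.

Fixpoint fset_pow (G : groupType) (S : {fset G}) (n : nat) : {fset G} :=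
  if n is n'.+1 then [fset (s * x)%g | s in S, x in fset_pow S n']%fset
  else [fset 1%g]%fset.

(* The limit always exists (Fekete) and the condition [1 < l] does not depend
   on [S]. *)
Definition exponential_growth (R : realType) (G : groupType) (H : set G) :
    Prop :=
  exists (S : {fset G}) (l : R),
    [/\ (1%g : G) \in S,
        forall s, s \in S -> (s^-1)%g \in S,
        generated_subgroup [set` S] = H,
        (fun n : nat => (#|` fset_pow S n|%:R : R) `^ (n%:R^-1)) @ \oo --> l
      & 1 < l].

Definition is_left_action (G : groupType) (T : Type) (act : G -> T -> T) :
    Prop :=
  (forall x, act 1%g x = x) /\
  (forall g h x, act (g * h)%g x = act g (act h x)).

Record is_circular_order (X : Type) (c : X -> X -> X -> int) : Prop := {
  circ_val : forall x1 x2 x3, c x1 x2 x3 \in [:: 0; 1; -1];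
  circ_eq0 : forall x1 x2 x3,
    c x1 x2 x3 = 0 <-> [\/ x1 = x2, x1 = x3 | x2 = x3];
  circ_cocycle : forall x1 x2 x3 x4,
    c x2 x3 x4 - c x1 x3 x4 + c x1 x2 x4 - c x1 x2 x3 = 0
}.

Definition circ_preserving (X Y : Type) (cX : X -> X -> X -> int)
    (cY : Y -> Y -> Y -> int) (f : X -> Y) : Prop :=
  forall x1 x2 x3, cY (f x1) (f x2) (f x3) = cX x1 x2 x3.

Definition C1_diffeo (T : Type) (C1 : (T -> T) -> Prop) (f : T -> T) : Prop :=
  exists g : T -> T, [/\ cancel f g, cancel g f, C1 f & C1 g].

Notation unit_interval R := (set_type `[0 : R, 1]%classic).

(* The limit is taken in the subspace topology of [0, 1], hence is a one-sided
   derivative at the endpoints. *)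
Definition C1_interval (R : realType)
    (f : unit_interval R -> unit_interval R) : Prop :=
  exists df : unit_interval R -> R, continuous df /\
    forall x : unit_interval R,
      (fun y : unit_interval R =>
         (\val (f y) - \val (f x)) / (\val y - \val x)) @ x^' -->
      df x.

Definition integers (R : realType) : zmodClosed R :=
  GRing.ZmodClosed.clone R (@Num.int_num_subdef R) _.

Definition circle (R : realType) : Type := Quotient.quot (integers R).

Definition circle_proj (R : realType) (t : R) : circle R :=
  (\pi_(Quotient.quot (integers R)) t)%qT.

(* [x, y, z] are distinct and met in this order when turning counterclockwise:
   they have real lifts a < b < c within one period. *)
Definition circle_positive (R : realType) (x y z : circle R) : Prop :=
  exists a b c : R,
    [/\ circle_proj a = x, circle_proj b = y, circle_proj c = z
      & [/\ a < b, b < c & c < a + 1]].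

Definition circle_order (R : realType) (x y z : circle R) : int :=
  if `[< circle_positive x y z >] then 1
  else if `[< circle_positive x z y >] then -1
  else 0.

(* The projection R -> R/Z is a local diffeomorphism for the smooth structure
   of R/Z, so C^1 means: locally represented by a C^1 map between lifts. *)
Definition C1_circle (R : realType) (f : circle R -> circle R) : Prop :=
  forall x : R, exists F : R -> R, \forall t \near x,
    [/\ circle_proj (F t) = f (circle_proj t),
        derivable F t 1
      & {for t, continuous (derive1 F)}].

(* Main.v *)
Require Import Defs.
From mathcomp Require Import all_boot all_order all_algebra.
From mathcomp Require Import finmap.
From mathcomp Require Import all_classical all_reals all_analysis.
From mathcomp Require Import zify ring lra.
Import Order.TTheory GRing.Theory Num.Theory.
Import numFieldNormedType.Exports.

Set Implicit Arguments.
Unset Strict Implicit.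
Unset Printing Implicit Defensive.

Local Open Scope classical_set_scope.
Local Open Scope ring_scope.

(** The action is realised by a Denjoy blow-up with carefully chosen lengths:
every point [x] is replaced by an interval [I_x] of length [l x], the intervals are
laid out in the given order so as to fill a set of full measure in [0, 1] or in the
circle, and [g] maps [I_x] onto [I_(g x)].  The point [x] is embedded as the left
end of [I_x].  Two choices make the action of class C^1.

The lengths are summable and almost invariant: for each [g], the ratio
[l (g x) / l x] tends to [1] as [x] leaves finite sets
([almost_invariant_length]).  This is where the growth hypothesis is used.  By
Fekete's lemma ([submult_root_cvg]) the powers of a finite symmetric set [S] of
group elements have at most [C * r ^+ n] elements, for every [r > 1]
([subexponential_card]); hence discounting the [S]-word distance to a finite set by
any factor [lam < 1] gives a summable function, which the elements of [S] distort by
a factor at most [lam^-1].  Taking the supremum of such functions, suitably scaled,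
over an exhaustion of the group and of the space with [lam] tending to [1] gives the
lengths.

The maps of [I_x] onto [I_(g x)] come from a family of diffeomorphisms between the
intervals [0, a] that is closed under composition, with derivative [1] at the ends
and uniformly close to [1] when the ratio of the lengths is ([dens_comp],
[dens_near1]).  Hence the derivative of [g], extended by [1] outside the intervals,
is a uniform sum of continuous functions with disjoint supports, and the map itself
is the sum of the displacements of the intervals; termwise differentiation
([is_derive_termwise]) shows that it is C^1.  The lifts to the line of the maps so
obtained compose up to an integer translation, because both sides have the same
derivative by the chain rule ([lift_deriv_comp], [lift_comp]).

The positions of the intervals are sums of lengths.  For a linear order, the
position of [x] is the total length of the smaller points.  For a circular order it
is the length of the arc from a base point to [x]; arc lengths add up modulo [1]
([arclen_add]), which gives both equivariance modulo integers and the preservation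
of the circular order.  *)

(** * Sums of nonnegative families *)

(** The sum of a nonnegative family over an arbitrary index type, as the
supremum of its finite partial sums.  It is meaningful for families that satisfy
[tbounded]. *)
Definition tsum (R : realType) (X : choiceType) (f : X -> R) : R :=
  sup [set \sum_(x <- E) f x | E in [set: {fset X}]].

(** Nonnegative and summable. *)
Definition tbounded (R : realType) (X : choiceType) (f : X -> R) : Prop :=
  (forall x, 0 <= f x) /\
  exists M, forall E : {fset X}, \sum_(x <- E) f x <= M.

Section Tsum.
Context {R : realType} {X : choiceType}.
Implicit Types (f g : X -> R) (E : {fset X}).

Lemma fsum_sub f E E' : (forall x, 0 <= f x) -> {subset E <= E'} ->
  \sum_(x <- E) f x <= \sum_(x <- E') f x.
Proof.
move=> f0 EE'; rewrite [leRHS](bigID (mem E)) /=.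
have -> : \sum_(x <- E' | x \in E) f x = \sum_(x <- E) f x.
  rewrite -big_filter; apply: perm_big; apply: uniq_perm => //.
    by rewrite filter_uniq.
  by move=> x; rewrite mem_filter; case: (boolP (x \in E)) => //= /EE' ->.
by rewrite lerDl sumr_ge0.
Qed.

Lemma tsum_ge f E : tbounded f -> \sum_(x <- E) f x <= tsum f.
Proof.
move=> [f0 [M fM]]; apply: ub_le_sup; last by exists E.
by exists M => _ [A _ <-].
Qed.

Lemma tsum_le f M : (forall E, \sum_(x <- E) f x <= M) -> tsum f <= M.
Proof.
move=> fM; apply: ge_sup; first by exists (\sum_(x <- (fset0 : {fset X})) f x), fset0.
by move=> _ [A _ <-].
Qed.

Lemma tsum_approx f (e : R) : tbounded f -> 0 < e ->
  exists E0, forall E, {subset E0 <= E} ->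
    tsum f - e < \sum_(x <- E) f x <= tsum f.
Proof.
move=> fb e0; have [f0 [M fM]] := fb.
have hs : has_sup [set \sum_(x <- E) f x | E in [set: {fset X}]].
  split; first by exists (\sum_(x <- (fset0 : {fset X})) f x), fset0.
  by exists M => _ [A _ <-].
have [_ [E0 _ <-] h] := sup_adherent e0 hs.
exists E0 => E sE; rewrite tsum_ge // andbT.
exact: lt_le_trans h (fsum_sub f0 sE).
Qed.

Lemma tbounded_le f g : tbounded g -> (forall x, 0 <= f x <= g x) -> tbounded f.
Proof.
move=> [_ [M gM]] fg; split; first by move=> x; have /andP[] := fg x.
exists M => E; apply: le_trans (gM E); apply: ler_sum => x _.
by have /andP[] := fg x.
Qed.

Lemma tboundedD f g : tbounded f -> tbounded g -> tbounded (fun x => f x + g x).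
Proof.
move=> [f0 [M fM]] [g0 [N gN]]; split; first by move=> x; rewrite addr_ge0.
by exists (M + N) => E; rewrite big_split lerD.
Qed.

Lemma tsumD f g : tbounded f -> tbounded g ->
  tsum (fun x => f x + g x) = tsum f + tsum g.
Proof.
move=> fb gb; apply/eqP; rewrite eq_le; apply/andP; split.
  by apply: tsum_le => E; rewrite big_split lerD // tsum_ge.
apply/ler_addgt0Pr => e e0.
have e20 : 0 < e / 2 by rewrite divr_gt0.
have [E1 h1] := tsum_approx fb e20.
have [E2 h2] := tsum_approx gb e20.
have /andP[+ _] := h1 (E1 `|` E2)%fset (fun x xE => (introT (fsetUP _ _ _) (or_introl xE))).
have /andP[+ _] := h2 (E1 `|` E2)%fset (fun x xE => (introT (fsetUP _ _ _) (or_intror xE))).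
have := tsum_ge (E1 `|` E2)%fset (tboundedD fb gb).
rewrite big_split /=; lra.
Qed.

Lemma eq_tsum f g : f =1 g -> tsum f = tsum g.
Proof. by move=> /funext ->. Qed.

Lemma tsum_ge0 f : tbounded f -> 0 <= tsum f.
Proof. by move=> fb; have := tsum_ge fset0 fb; rewrite big_seq_fset0. Qed.

Lemma tsum_ge1 f x : tbounded f -> f x <= tsum f.
Proof. by move=> fb; have := tsum_ge [fset x]%fset fb; rewrite big_seq_fset1. Qed.

Lemma ler_tsum f g : tbounded g -> (forall x, 0 <= f x <= g x) -> tsum f <= tsum g.
Proof.
move=> gb fg; apply: tsum_le => E; apply: le_trans (tsum_ge E gb).
by apply: ler_sum => x _; have /andP[] := fg x.
Qed.

Lemma tbounded_mask f (P : pred X) : tbounded f -> tbounded (fun x => (P x)%:R * f x).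
Proof.
move=> fb; have [f0 _] := fb; apply: (tbounded_le fb) => x.
by case: (P x); rewrite ?mul1r ?mul0r ?f0 ?lexx.
Qed.

Lemma tsum_mask1 f (x : X) : tbounded f -> tsum (fun y => (y == x)%:R * f y) = f x.
Proof.
move=> fb; have [f0 _] := fb; apply/eqP; rewrite eq_le; apply/andP; split; last first.
  by have := tsum_ge1 x (tbounded_mask (pred1 x) fb); rewrite /= eqxx mul1r.
apply: tsum_le => E; have [xE|xE] := boolP (x \in E).
  rewrite (big_fsetD1 x) //= eqxx mul1r big_seq big1 ?addr0 // => y.
  by rewrite !inE => /andP[/negbTE ->]; rewrite mul0r.
rewrite big_seq big1 // => y yE; case: eqP => [yx|]; last by rewrite mul0r.
by move: xE; rewrite -yx yE.
Qed.

Lemma tsumZ f (c : R) : 0 <= c -> tbounded f -> tsum (fun x => c * f x) = c * tsum f.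
Proof.
move=> c0 fb; have [f0 [M fM]] := fb; apply/eqP; rewrite eq_le; apply/andP; split.
  by apply: tsum_le => E; rewrite -mulr_sumr ler_wpM2l // tsum_ge.
have [->|cn0] := eqVneq c 0.
  rewrite mul0r; apply: tsum_ge0; split=> [x|]; first by rewrite mul0r.
  by exists 0 => E; rewrite big1 // => x _; rewrite mul0r.
have cp : 0 < c by rewrite lt_neqAle eq_sym cn0.
rewrite -ler_pdivlMl //; apply: tsum_le => E; rewrite ler_pdivlMl // mulr_sumr.
apply: (@tsum_ge (fun x => c * f x)); split=> [x|]; first by rewrite mulr_ge0.
by exists (c * M) => A; rewrite -mulr_sumr ler_wpM2l.
Qed.

Lemma tbounded_inj f (h : X -> X) : injective h -> tbounded f -> tbounded (f \o h).
Proof.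
move=> hi [f0 [M fM]]; split=> [x /=|]; first exact: f0.
exists M => E; apply: le_trans (fM [fset h x | x in E]%fset).
by rewrite big_imfset //= => x y _ _; exact: hi.
Qed.

Lemma tsum_inj_le f (h : X -> X) : injective h -> tbounded f ->
  tsum (f \o h) <= tsum f.
Proof.
move=> hi fb; apply: tsum_le => E.
have := tsum_ge [fset h x | x in E]%fset fb.
by rewrite big_imfset //= => x y _ _; exact: hi.
Qed.

Lemma tsum_bij f (h h' : X -> X) : cancel h h' -> cancel h' h -> tbounded f ->
  tsum (f \o h) = tsum f.
Proof.
move=> hK h'K fb; apply/eqP; rewrite eq_le (tsum_inj_le (can_inj hK)) //=.
have {1}-> : f = (f \o h) \o h' by apply/funext => x /=; rewrite h'K.
apply: tsum_inj_le (can_inj h'K) _; exact: tbounded_inj (can_inj hK) fb.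
Qed.

End Tsum.

(** * Growth of finite symmetric sets *)

Section SubmultiplicativeSequences.
Context {R : realType} (a : nat -> R).
Hypothesis a_ge1 : forall n, 1 <= a n.
Hypothesis a_sub : forall m n, a (m + n)%N <= a m * a n.

Let a_gt0 n : 0 < a n. Proof. exact: lt_le_trans ltr01 (a_ge1 n). Qed.

(** One value below the geometric rate bounds the whole sequence, by division
with remainder by [m]. *)
Lemma submult_bound (r : R) (m : nat) : 0 < r -> (0 < m)%N -> a m <= r ^+ m ->
  exists2 C, 0 < C & forall n, a n <= C * r ^+ n.
Proof.
move=> r0 m0 am.
pose C := \sum_(i < m) a i / r ^+ i.
have C0 i : (i < m)%N -> a i / r ^+ i <= C.
  move=> im; rewrite /C (bigD1 (Ordinal im)) //= lerDl sumr_ge0 // => j _.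
  by rewrite divr_ge0 ?exprn_ge0 // ltW.
exists C.
  by apply: lt_le_trans (C0 _ m0); rewrite divr_gt0 ?exprn_gt0.
move=> n; have [k] := ubnP n; elim: k n => // k IH n; rewrite ltnS => nk.
have [nm|mn] := ltnP n m; first by rewrite -ler_pdivrMr ?exprn_gt0 ?C0.
rewrite -(subnKC mn); apply: le_trans (a_sub _ _) _; rewrite exprD mulrCA.
apply: ler_pM => //; try exact: ltW.
by apply: IH; apply: leq_trans nk; rewrite ltn_subrL m0 (leq_trans m0).
Qed.

Lemma expr_unbounded (C x : R) : 1 < x -> exists n0, forall n, (n0 <= n)%N -> C <= x ^+ n.
Proof.
move=> x1.
have bern n : n%:R * (x - 1) <= x ^+ n.
  elim: n => [|n IH]; first by rewrite mul0r expr0 ler01.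
  have h : 1 <= x ^+ n by rewrite exprn_ege1 // ltW.
  rewrite exprS -natr1; nra.
have x10 : 0 < x - 1 by rewrite subr_gt0.
exists (Num.truncn (C / (x - 1))).+1 => n hn; apply: le_trans (bern n).
rewrite -ler_pdivrMr //; apply: ltW; apply: lt_le_trans (truncnS_gt _) _.
by rewrite ler_nat.
Qed.

Let root n : R := a n `^ n%:R^-1.

Let rootK n : (0 < n)%N -> root n ^+ n = a n.
Proof.
move=> n0; rewrite /root -powR_mulrn ?powR_ge0 // -powRrM mulVf ?powRr1 ?ltW //.
by rewrite pnatr_eq0 -lt0n.
Qed.

(** Fekete's lemma as an alternative: either the sequence grows at most like
[r ^+ n], or its [n]-th roots converge to a limit greater than [1], namely their
infimum. *)
Lemma submult_root_cvg (r : R) : 1 < r ->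
  (exists2 C, 0 < C & forall n, a n <= C * r ^+ n) \/
  (exists2 l : R, 1 < l & (fun n => a n `^ n%:R^-1) @ \oo --> l).
Proof.
move=> r1; have r0 : 0 < r by apply: lt_trans r1.
have [[m m0 am]|nex] := pselect (exists2 m, (0 < m)%N & a m <= r ^+ m).
  by left; exact: submult_bound am.
right.
have root_ge n : (0 < n)%N -> r <= root n.
  move=> n0; rewrite leNgt; apply/negP => h; apply: nex; exists n => //.
  rewrite -rootK //; apply: lerXn2r; rewrite ?nnegrE ?powR_ge0 //; exact: ltW.
pose A := [set root n | n in [set n | (0 < n)%N]].
have A0 : A !=set0 by exists (root 1), 1%N.
have Alb : lbound A r by move=> _ [n n0 <-]; exact: root_ge.
have hiA : has_inf A by split => //; exists r.
have rl : r <= inf A by exact: lb_le_inf.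
exists (inf A); first exact: lt_le_trans rl.
have l0 : 0 < inf A by exact: lt_le_trans rl.
apply/cvgrPdist_le => e e0.
have e20 : 0 < e / 2 by rewrite divr_gt0.
have [_ [m m0 <-] hm] := inf_adherent e20 hiA.
set s := inf A + e / 2 in hm.
have s0 : 0 < s by rewrite /s addr_gt0.
have am : a m <= s ^+ m.
  rewrite -rootK //; apply: lerXn2r; rewrite ?nnegrE ?powR_ge0 //; exact: ltW.
have [C C0 aC] := submult_bound s0 m0 am.
have [n0 hn0] := @expr_unbounded C ((inf A + e) / s)
  ltac:(by rewrite ltr_pdivlMr // mul1r /s; lra).
near=> n.
have npos : (0 < n)%N by near: n; exact: nbhs_infty_gt.
have lroot : inf A <= root n by apply: ge_inf; [exists r | exists n].
rewrite distrC ger0_norm ?subr_ge0 // lerBlDl.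
have : root n ^+ n <= (inf A + e) ^+ n.
  rewrite rootK //; apply: le_trans (aC n) _.
  rewrite -ler_pdivlMr ?exprn_gt0 // -expr_div_n; apply: hn0.
  by near: n; exact: nbhs_infty_ge.
by rewrite ler_pXn2r // ?nnegrE ?powR_ge0 // addr_ge0 ?ltW.
Unshelve. all: by end_near.
Qed.

End SubmultiplicativeSequences.

Section FsetPow.
Context {G : groupType} (S : {fset G}).

Lemma fset_powD m n x : x \in fset_pow S (m + n) ->
  exists y z, [/\ y \in fset_pow S m, z \in fset_pow S n & x = (y * z)%g].
Proof.
elim: m x => [|m IH] x /=.
  by rewrite add0n => xS; exists 1%g, x; rewrite mul1g inE eqxx.
move=> /imfset2P[s sS [w wS ->]]; have [y [z [yS zS ->]]] := IH _ wS.
exists (s * y)%g, z; split=> //; last by rewrite mulgA.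
by apply/imfset2P; exists s => //; exists y.
Qed.

Lemma card_imfset2_le (K K' K'' : choiceType) (f : K -> K' -> K'')
   (A : {fset K}) (B : {fset K'}) :
  (#|` [fset f x y | x in A, y in B]%fset| <= #|` A| * #|` B|)%N.
Proof.
have sub : {subset [fset f x y | x in A, y in B]%fset <=
    [seq f x y | x <- A, y <- B]}.
  by move=> _ /imfset2P[x xA [y yB ->]]; apply/allpairsP; exists (x, y).
by rewrite -[X in (_ <= X)%N](size_allpairs f) uniq_leq_size.
Qed.

Lemma card_fset_powD m n :
  (#|` fset_pow S (m + n)| <= #|` fset_pow S m| * #|` fset_pow S n|)%N.
Proof.
apply: leq_trans (card_imfset2_le (fun x y : G => (x * y)%g) _ _).
apply: fsubset_leq_card; apply/fsubsetP => x /fset_powD[y [z [yS zS ->]]].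
by apply/imfset2P; exists y => //; exists z.
Qed.

Lemma fset_pow_1 n : (1%g : G) \in S -> (1%g : G) \in fset_pow S n.
Proof.
move=> S1; elim: n => [|n IH] /=; first by rewrite inE.
apply/imfset2P; exists 1%g; first exact: S1.
exists 1%g; [exact: IH | by rewrite mulg1].
Qed.

Lemma generated_subgroup_is_subgroup : is_subgroup (generated_subgroup [set` S]).
Proof.
split.
- by move=> H [[]].
- by move=> x y hx hy H HP; have [[_ hM _] _] := HP; apply: hM; [exact: hx|exact: hy].
- by move=> x hx H HP; have [[_ _ hV] _] := HP; apply: hV; exact: hx.
Qed.

(** If the limit of Fekete's lemma exceeded [1], the subgroup generated by [S]
would have exponential growth. *)
Lemma subexponential_card (R : realType) (r : R) :
  (forall H : set G, is_subgroup H -> finitely_generated H ->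
       ~ exponential_growth R H) ->
  (1%g : G) \in S -> (forall s, s \in S -> (s^-1)%g \in S) -> 1 < r ->
  exists2 C, 0 < C & forall n, #|` fset_pow S n|%:R <= C * r ^+ n.
Proof.
move=> Gg S1 SV r1.
have a1 n : 1 <= #|` fset_pow S n|%:R :> R.
  rewrite ler1n cardfs_gt0; apply/fset0Pn; exists 1%g; exact: fset_pow_1.
have aM m n : #|` fset_pow S (m + n)|%:R <= #|` fset_pow S m|%:R * #|` fset_pow S n|%:R :> R.
  by rewrite -natrM ler_nat card_fset_powD.
have [//|[l l1 cl]] := submult_root_cvg a1 aM r1.
exfalso; apply: (Gg (generated_subgroup [set` S])).
- exact: generated_subgroup_is_subgroup.
- by exists S.
- by exists S, l.
Qed.

End FsetPow.

(** * Almost invariant summable lengths *)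

Lemma countable_exhaustion (T : choiceType) : countable [set: T] ->
  exists F : nat -> {fset T}, (forall k m, (k <= m)%N -> {subset F k <= F m}) /\
    forall x, exists k, x \in F k.
Proof.
move=> /countable_injP[e einj].
have fin k : finite_set [set x : T | (e x < k)%N].
  apply: (@finite_preimage _ _ `I_k e) => //.
  by move=> x y _ _; apply: einj; rewrite in_setT.
have memF k x : (x \in fset_set [set x : T | (e x < k)%N]) = (e x < k)%N.
  by rewrite in_fset_set //; apply/idP/idP; rewrite inE.
exists (fun k => fset_set [set x : T | (e x < k)%N]); split.
  by move=> k m km x; rewrite !memF => h; exact: leq_trans km.
by move=> x; exists (e x).+1; rewrite memF.
Qed.

(** The sets [A k n] will be the balls of radius [n] about a finite set [F k] of
points, for the word metric of a finite set [S k] of group elements; [F k] and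
[S k] increase with [k] and exhaust the space and the group.  Discounting
distances by [lam k] gives a summable function [f k], which the elements of [S k]
distort by a factor at most [(lam k)^-1]; this factor tends to [1].  The length is
[sup_k c k * f k] for small constants [c k]: as [f k] is negligible with respect to
[f m] at infinity when [k < m], only the terms of large index matter off a finite
set. *)
Section Weights.
Context {R : realType} {X : choiceType}.
Variables (A : nat -> nat -> {fset X}) (lam : nat -> R) (M : nat -> R).
Hypothesis A_cover : forall x, exists k, x \in A k 0.
Hypothesis A_mono : forall k m n, (k <= m)%N -> {subset A k n <= A m n}.
Hypothesis lam_gt0 : forall k, 0 < lam k.
Hypothesis lam_lt1 : forall k, lam k < 1.
Hypothesis lam_mono : forall k m, (k < m)%N -> lam k < lam m.
Hypothesis lam_lim : forall e, 0 < e -> exists k, forall m, (k <= m)%N -> (lam m)^-1 <= 1 + e.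
Hypothesis M_ge1 : forall k, 1 <= M k.
Hypothesis A_sum : forall k N, \sum_(n < N) lam k ^+ n * #|` A k n|%:R <= M k.

(** The distance of [x] to the centre of the balls [A k]; the value is [0], and is
not used, if no ball contains [x]. *)
Let rank k x : nat :=
  match pselect (exists n, x \in A k n) with
  | left h => ex_minn h | right _ => 0%N end.

Let f k x : R := if `[< exists n, x \in A k n >] then lam k ^+ rank k x else 0.

Let f_ge k x n : x \in A k n -> lam k ^+ n <= f k x.
Proof.
move=> xA; rewrite /f asboolT; last by exists n.
rewrite /rank; case: pselect => [h|[]]; last by exists n.
case: ex_minnP => m xm hm; apply: ler_wiXn2l; [exact: ltW..|exact: hm].
Qed.

Let f_val k x : f k x = 0 \/ x \in A k (rank k x) /\ f k x = lam k ^+ rank k x.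
Proof.
rewrite /f; case: asboolP => h; [right|by left].
by split => //; rewrite /rank; case: pselect => // h'; case: ex_minnP.
Qed.

Let f_ge0 k x : 0 <= f k x.
Proof. by have [->|[_ ->]] := f_val k x; rewrite ?exprn_ge0 // ltW. Qed.

Let f_le1 k x : f k x <= 1.
Proof. by have [->|[_ ->]] := f_val k x; rewrite ?ler01 // exprn_ile1 // ltW. Qed.

Let f_sum k (E : {fset X}) : \sum_(x <- E) f k x <= M k.
Proof.
pose N := (\max_(x <- E) rank k x).+1.
apply: le_trans (A_sum k N).
have h x : x \in E -> f k x <= \sum_(n < N) lam k ^+ n * (x \in A k n)%:R.
  move=> xE; have [->|[xA ->]] := f_val k x.
    by apply: sumr_ge0 => n _; rewrite mulr_ge0 ?exprn_ge0 // ltW.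
  have hN : (rank k x < N)%N by rewrite ltnS; exact: leq_bigmax_seq.
  rewrite (bigD1 (Ordinal hN)) //= xA mulr1 lerDl sumr_ge0 // => n _.
  by rewrite mulr_ge0 ?exprn_ge0 // ltW.
apply: (@le_trans _ _ (\sum_(x <- E) \sum_(n < N) lam k ^+ n * (x \in A k n)%:R)).
  by rewrite !big_seq; apply: ler_sum.
rewrite exchange_big /=; apply: ler_sum => n _; rewrite -mulr_sumr.
apply: ler_wpM2l; first by rewrite exprn_ge0 // ltW.
rewrite -natr_sum ler_nat.
rewrite -[X in (X <= _)%N]big_mkcond /= sum1_count -size_filter.
apply: uniq_leq_size; first by rewrite filter_uniq.
by move=> x; rewrite mem_filter => /andP[].
Qed.

(** The [k]-th term has total mass at most [2^-1 ^+ k]. *)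
Let c k : R := 2^-1 ^+ k / M k.

Let c_gt0 k : 0 < c k.
Proof. by rewrite divr_gt0 ?exprn_gt0 ?invr_gt0 // (lt_le_trans ltr01). Qed.

Let c_le1 k : c k <= 1.
Proof.
rewrite ler_pdivrMr ?(lt_le_trans ltr01) // mul1r; apply: le_trans (M_ge1 k).
by rewrite exprn_ile1 // invf_le1 // ler1n.
Qed.

Let ell x : R := sup (range (fun k => c k * f k x)).

Let ell_hs x : has_sup (range (fun k => c k * f k x)).
Proof.
split; first by exists (c 0 * f 0 x), 0%N.
exists 1 => _ [k _ <-]; rewrite -[leRHS](mulr1 1); apply: ler_pM => //.
exact: ltW.
Qed.

Let ell_ge k x : c k * f k x <= ell x.
Proof. by apply: ub_le_sup; [have [] := ell_hs x | exists k]. Qed.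

Let ell_gt0 x : 0 < ell x.
Proof.
have [k xk] := A_cover x; apply: lt_le_trans (ell_ge k x).
by rewrite mulr_gt0 // (lt_le_trans _ (f_ge xk)).
Qed.

Let ell_sum (E : {fset X}) : \sum_(x <- E) ell x <= 4.
Proof.
(* Some term is at least half of the supremum. *)
have h x : exists k, ell x / 2 <= c k * f k x.
  have [_ [k _ <-] hk] := sup_adherent (divr_gt0 (ell_gt0 x) (ltr0n R 2)) (ell_hs x).
  exists k; apply: ltW; apply: le_lt_trans hk; rewrite -/(ell x).
  by rewrite {2}(splitr (ell x)) addrK.
have [kk hk] := choice h.
pose N := (\max_(x <- E) kk x).+1.
have key x : x \in E -> ell x <= 2 * \sum_(k < N) c k * f k x.
  move=> xE; rewrite mulrC -ler_pdivrMr //; apply: le_trans (hk x) _.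
  have hN : (kk x < N)%N by rewrite ltnS; exact: leq_bigmax_seq.
  rewrite (bigD1 (Ordinal hN)) //= lerDl sumr_ge0 // => n _.
  by rewrite mulr_ge0 // ltW.
apply: (@le_trans _ _ (\sum_(x <- E) 2 * \sum_(k < N) c k * f k x)).
  by rewrite !big_seq; apply: ler_sum.
rewrite -mulr_sumr exchange_big /=.
have h2 : \sum_(k < N) 2^-1 ^+ k <= 2 :> R.
  have -> : \sum_(k < N) 2^-1 ^+ k = 2 - 2 * 2^-1 ^+ N :> R.
    elim: (N) => [|n IH]; first by rewrite big_ord0 expr0 mulr1 subrr.
    by rewrite big_ord_recr /= IH exprS; field.
  by rewrite gerBl mulr_ge0 // exprn_ge0 // invr_ge0.
apply: (@le_trans _ _ (2 * \sum_(k < N) 2^-1 ^+ k)); last by lra.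
apply: ler_wpM2l => //; apply: ler_sum => k _; rewrite -mulr_sumr.
rewrite /c mulrAC ler_pdivrMr ?(lt_le_trans ltr01) //.
by apply: ler_wpM2l; rewrite ?exprn_ge0 ?invr_ge0.
Qed.

(** If [n] is the distance of [x] for [k], then [f k x = lam k ^+ n] and
[lam K ^+ n <= f K x]; as [lam k < lam K], the inequality fails only in a ball. *)
Let f_negligible k K : (k < K)%N ->
  exists E : {fset X}, forall x, x \notin E -> c k * f k x <= c K * f K x.
Proof.
move=> kK.
have hx : 1 < lam K / lam k by rewrite ltr_pdivlMr // mul1r lam_mono.
have [n0 hn0] := @expr_unbounded R (c k / c K) _ hx.
exists (\bigcup_(n <- iota 0 n0) A k n)%fset => x xE.
have [->|[xA ->]] := f_val k x; first by rewrite mulr0 mulr_ge0 // ltW.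
have hr : (n0 <= rank k x)%N.
  rewrite leqNgt; apply/negP => h; move/negP: xE; apply.
  apply/bigfcupP; exists (rank k x) => //.
  by rewrite mem_iota h.
apply: (@le_trans _ _ (c K * lam K ^+ rank k x)).
  have := hn0 _ hr; rewrite expr_div_n ler_pdivlMr ?exprn_gt0 //.
  by rewrite mulrAC ler_pdivrMr // mulrC [leRHS]mulrC.
apply: ler_wpM2l; first exact: ltW.
by apply: f_ge; exact: (A_mono (ltnW kK)).
Qed.

Let f_bad K : exists E : {fset X}, forall x, x \notin E ->
  forall k, (k < K)%N -> c k * f k x <= c K * f K x.
Proof.
suff H m : (m <= K)%N -> exists E : {fset X}, forall x, x \notin E ->
  forall k, (k < m)%N -> c k * f k x <= c K * f K x by exact: H.
elim: m => [_|m IH mK]; first by exists fset0.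
have [E hE] := IH (ltnW mK); have [E' hE'] := f_negligible mK.
exists (E `|` E')%fset => x; rewrite inE negb_or => /andP[/hE h1 /hE' h2] k.
by rewrite ltnS leq_eqVlt => /predU1P[->|/h1].
Qed.

(** The bijection [s] plays the part of a group element whose inverse [s'] lies
in [S k] for all large [k]. *)
Lemma weights_exist : exists l : X -> R, [/\ forall x, 0 < l x, tbounded l &
  forall (s s' : X -> X), cancel s s' -> cancel s' s ->
    (exists k0, forall k n x, (k0 <= k)%N -> x \in A k n -> s' x \in A k n.+1) ->
    forall e, 0 < e -> exists E : {fset X},
      forall x, x \notin E -> l (s x) <= (1 + e) * l x].
Proof.
exists ell; split=> //.
  by split=> [x|]; [exact: ltW | exists 4].
move=> s s' sK s'K [k0 hs] e e0.
have [k1 hk1] := lam_lim e0.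
pose K := maxn k0 k1.
have [E hE] := f_bad K.
exists [fset s' x | x in E]%fset => x xE.
have sxE : s x \notin E.
  by apply: contra xE => h; apply/imfsetP; exists (s x); rewrite ?sK.
(* The terms of index less than K are dominated by the term of index K. *)
have tail k : (K <= k)%N -> c k * f k (s x) <= (1 + e) * ell x.
  move=> Kk; apply: (@le_trans _ _ ((1 + e) * (c k * f k x))); last first.
    by apply: ler_wpM2l => //; rewrite addr_ge0 // ltW.
  rewrite mulrCA; apply: ler_wpM2l; first exact: ltW.
  have [->|[xA ->]] := f_val k (s x).
    by rewrite mulr_ge0 // addr_ge0 // ltW.
  have /f_ge := hs k _ _ (leq_trans (leq_maxl _ _) Kk) xA; rewrite sK exprS.
  have := hk1 k (leq_trans (leq_maxr _ _) Kk).
  move=> h1 h2; apply: (@le_trans _ _ ((lam k)^-1 * f k x)); last by rewrite ler_wpM2r.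
  by rewrite ler_pdivlMl.
apply: ge_sup; first by have [] := ell_hs (s x).
move=> _ [k _ <-]; have [kK|] := ltnP k K; last exact: tail.
exact: le_trans (hE _ sxE _ kK) (tail _ (leqnn K)).
Qed.

End Weights.

(** The only use of the growth hypothesis: there is a summable positive function
that every group element preserves up to a factor tending to [1] at infinity. *)
Lemma almost_invariant_length (R : realType) (G : groupType) (X : choiceType)
    (a : G -> X -> X) :
  countable [set: G] -> countable [set: X] ->
  (forall H : set G, is_subgroup H -> finitely_generated H ->
       ~ exponential_growth R H) ->
  is_left_action a ->
  exists l : X -> R, [/\ forall x, 0 < l x, tbounded l &
    forall g e, 0 < e -> exists E : {fset X},
      forall x, x \notin E -> l (a g x) <= (1 + e) * l x].
Proof.
move=> Gc Xc Gg [a1 aM].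
have [T [Tmono Tcov]] := countable_exhaustion Gc.
have [F [Fmono Fcov]] := countable_exhaustion Xc.
pose S k : {fset G} :=
  (1%g |` (T k `|` [fset (x^-1)%g | x in T k]))%fset.
have S1 k : (1%g : G) \in S k by rewrite !inE eqxx.
have SV k s : s \in S k -> (s^-1)%g \in S k.
  rewrite !in_fsetU in_fset1 => /or3P[/eqP ->|h|/imfsetP[t tT ->]].
  - by rewrite invg1 in_fset1 eqxx.
  - apply/or3P; apply: Or33; apply/imfsetP; by exists s.
  - by rewrite invgK tT orbT.
have Smono k m : (k <= m)%N -> {subset S k <= S m}.
  move=> km s; rewrite !in_fsetU in_fset1 => /or3P[->//|/(Tmono _ _ km) ->|].
    by rewrite orbT.
  move=> /imfsetP[t tT ->]; rewrite in_imfset ?orbT //.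
  exact: Tmono tT.
pose lam k : R := 1 - (k.+2%:R)^-1.
have lam0 k : 0 < lam k by rewrite subr_gt0 invf_lt1 // ltr1n.
have lam1 k : lam k < 1 by rewrite gtrBl invr_gt0.
have lamm k m : (k < m)%N -> lam k < lam m.
  by move=> km; rewrite ltrD2l ltrN2 ltf_pV2 ?posrE // ltr_nat.
have laml e : 0 < e -> exists k, forall m, (k <= m)%N -> (lam m)^-1 <= 1 + e.
  move=> e0; exists (Num.truncn e^-1).+1 => m hm.
  have h1 : e^-1 < m.+1%:R.
    by apply: lt_le_trans (truncnS_gt _) _; rewrite ler_nat; exact: leqW.
  have -> : (lam m)^-1 = 1 + (m.+1%:R)^-1.
    rewrite /lam -(@natr1 _ m.+1); field.
    have m0 : 0 <= m%:R :> R by exact: ler0n.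
    by rewrite !lt0r_neq0 //; lra.
  by rewrite lerD2l -[leRHS]invrK lef_pV2 ?posrE ?invr_gt0 // ltW.
pose A k n : {fset X} := [fset a s x | s in fset_pow (S k) n, x in F k]%fset.
have powmono k m n : (k <= m)%N -> {subset fset_pow (S k) n <= fset_pow (S m) n}.
  move=> km; elim: n => [|n IH] x //= /imfset2P[s sS [y yS ->]].
  by apply/imfset2P; exists s; [exact: Smono sS|exists y; [exact: IH|]].
have Acov x : exists k, x \in A k 0.
  have [k xk] := Fcov x; exists k; apply/imfset2P; exists 1%g; first by rewrite !inE.
  by exists x; rewrite ?a1.
have Amono k m n : (k <= m)%N -> {subset A k n <= A m n}.
  move=> km _ /imfset2P[s sS [y yS ->]]; apply/imfset2P; exists s.
    exact: powmono sS.
  by exists y => //; exact: Fmono yS.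
have Asum k : exists M, 1 <= M /\ forall N, \sum_(n < N) lam k ^+ n * #|` A k n|%:R <= M.
  (* Any rate r with 1 < r and lam k * r < 1 makes the series converge. *)
  pose r : R := (1 + (lam k)^-1) / 2.
  have li : 1 < (lam k)^-1 by rewrite invf_gt1.
  have r1 : 1 < r by rewrite /r; lra.
  have r0 : 0 < r by lra.
  pose t := lam k * r.
  have t1 : t < 1 by rewrite /t mulrC -ltr_pdivlMr // mul1r /r; lra.
  have t0 : 0 < t by rewrite mulr_gt0.
  have [C C0 hC] := subexponential_card Gg (S1 k) (@SV k) r1.
  have pos : 0 <= C * #|` F k|%:R by rewrite mulr_ge0 // ltW.
  exists (1 + C * #|` F k|%:R / (1 - t)); split.
    by rewrite lerDl divr_ge0 // subr_ge0 ltW.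
  move=> N; apply: (@le_trans _ _ (C * #|` F k|%:R / (1 - t))); last by rewrite lerDr.
  apply: (@le_trans _ _ (\sum_(n < N) (C * #|` F k|%:R) * t ^+ n)).
    apply: ler_sum => n _; rewrite /t exprMn [leRHS]mulrCA.
    apply: ler_wpM2l; first by rewrite exprn_ge0 // ltW.
    apply: (@le_trans _ _ ((#|` fset_pow (S k) n| * #|` F k|)%N%:R)).
      by rewrite ler_nat card_imfset2_le.
    by rewrite natrM mulrAC ler_wpM2r.
  rewrite -mulr_sumr; apply: ler_wpM2l => //.
  have t1' : 1 - t != 0 by rewrite subr_eq0 eq_sym lt_eqF.
  have -> : \sum_(n < N) t ^+ n = (1 - t ^+ N) / (1 - t).
    elim: (N) => [|n IH]; first by rewrite big_ord0 expr0 subrr mul0r.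
    by rewrite big_ord_recr /= IH exprSr; field.
  by rewrite ler_pdivrMr ?subr_gt0 // mulVf // gerBl exprn_ge0 // ltW.
have [M hM] := choice Asum.
have [l [l0 lb lE]] := weights_exist Acov Amono lam0 lam1 lamm laml
  (fun k => proj1 (hM k)) (fun k => proj2 (hM k)).
exists l; split=> // g e e0.
apply: (lE _ (a (g^-1)%g)) => //.
- by move=> x; rewrite -aM mulVg a1.
- by move=> x; rewrite -aM mulgV a1.
have [k0 hk0] := Tcov g; exists k0 => k n x kk.
move=> /imfset2P[s sS [y yF ->]]; apply/imfset2P; exists (g^-1 * s)%g.
  apply/imfset2P; exists (g^-1)%g; last by exists s.
  by apply: SV; rewrite !in_fsetU (Tmono _ _ kk _ hk0) orbT.
by exists y; rewrite ?aM.
Qed.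

(** * Differentiation on the line *)

Section EpsilonDelta.
Context {R : realType}.
Implicit Types (f g : R -> R) (t d : R).

Lemma nbhs_eps (P : R -> Prop) t : (\forall s \near t, P s) <->
  exists2 r, 0 < r & forall s, `|s - t| < r -> P s.
Proof.
split.
  move=> /nbhs_ballP[r /= r0 h]; exists r => // s hs; apply: h.
  by rewrite /ball /= distrC.
move=> [r r0 h]; apply/nbhs_ballP; exists r => //= s; rewrite /ball /= distrC => hs.
exact: h.
Qed.

Lemma continuous_eps f t : {for t, continuous f} <->
  forall e, 0 < e -> exists2 r, 0 < r & forall s, `|s - t| < r -> `|f s - f t| <= e.
Proof.
split.
  move=> /cvgrPdist_le h e /h /nbhs_eps[r r0 hr]; exists r => // s /hr.
  by rewrite distrC.
move=> h; apply/cvgrPdist_le => e /h[r r0 hr]; apply/nbhs_eps; exists r => // s /hr.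
by rewrite distrC.
Qed.

Lemma is_derive_eps f t d : is_derive t 1 f d <->
  forall e, 0 < e -> exists2 r, 0 < r &
    forall s, `|s - t| < r -> `|f s - f t - d * (s - t)| <= e * `|s - t|.
Proof.
have E h : h != 0 -> `|f (h + t) - f t - d * h| = `|h| * `|d - h^-1 * (f (h + t) - f t)|.
  move=> h0; rewrite -normrM distrC; congr (`|_|); field => //.
split.
  move=> [df dE] e e0.
  have cv : h^-1 *: (f (h *: 1 + t) - f t) @[h --> 0^'] --> d by rewrite -dE; exact: df.
  have /cvgrPdist_le/(_ e e0)/nbhs_eps[r r0 hr] := cv.
  exists r => // s hs.
  have [->|st] := eqVneq s t; first by rewrite !subrr mulr0 subr0 normr0 mulr0.
  have h0 : s - t != 0 by rewrite subr_eq0.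
  have := hr (s - t); rewrite subr0 => /(_ hs h0) /=.
  rewrite -[_ *: 1]/(_ * 1) mulr1 -[_ *: _]/(_ * _) => hh.
  have := E _ h0; rewrite subrK => ->; rewrite mulrC ler_wpM2r //.
  by move: hh; rewrite subrK.
move=> H.
have cv : h^-1 *: (f (h *: 1 + t) - f t) @[h --> 0^'] --> d.
  apply/cvgrPdist_le => e /H[r r0 hr]; apply/nbhs_eps.
  exists r => // h; rewrite subr0 => hs h0 /=.
  rewrite -[h *: 1]/(h * 1) mulr1 -[h^-1 *: _]/(h^-1 * _).
  have hp : 0 < `|h| by rewrite normr_gt0.
  have := hr (h + t); rewrite addrK => /(_ hs); rewrite E // mulrC.
  by rewrite ler_pM2r.
apply: DeriveDef; last exact: cvg_lim cv.
by apply/cvg_ex; exists d.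
Qed.

(** Caratheodory's criterion. *)
Lemma is_derive_slope f (phi : R -> R) t : {for t, continuous phi} ->
  (\forall s \near t, f s - f t = phi s * (s - t)) -> is_derive t 1 f (phi t).
Proof.
move=> /continuous_eps cphi /nbhs_eps[r r0 hr]; apply/is_derive_eps => e e0.
have [r' r'0 hr'] := cphi e e0.
exists (Num.min r r') => [|s]; first by rewrite lt_min r0.
rewrite lt_min => /andP[/hr -> /hr' h].
by rewrite -mulrBl normrM ler_wpM2r.
Qed.

Lemma is_derive_continuous f t d : is_derive t 1 f d -> {for t, continuous f}.
Proof. by move=> [h _]; apply: differentiable_continuous; apply/derivable1_diffP. Qed.

(** Two functions that agree at [c] and have the same derivative there. *)
Lemma is_derive_glue (v w : R -> R) c t d :
  (t <= c -> is_derive t 1 v d) -> (c <= t -> is_derive t 1 w d) -> v c = w c ->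
  is_derive t 1 (fun s => if s <= c then v s else w s) d.
Proof.
move=> hv hw vw; apply/is_derive_eps => e e0.
have [tc|ct|tc] := ltgtP t c.
- have /is_derive_eps/(_ e e0)[r r0 hr] := hv (ltW tc).
  exists (Num.min r (c - t)) => [|s]; first by rewrite lt_min r0 subr_gt0.
  rewrite lt_min => /andP[/hr h hs]; have -> // : s <= c.
  have := ler_norm (s - t); lra.
- have /is_derive_eps/(_ e e0)[r r0 hr] := hw (ltW ct).
  exists (Num.min r (t - c)) => [|s]; first by rewrite lt_min r0 subr_gt0.
  rewrite lt_min => /andP[/hr h hs]; have -> // : (s <= c) = false.
  apply/negbTE; rewrite -ltNge; have := ler_norm (t - s); rewrite distrC; lra.
- rewrite -tc in vw *.
  have /is_derive_eps/(_ e e0)[r r0 hr] : is_derive t 1 v d by apply: hv; rewrite tc.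
  have /is_derive_eps/(_ e e0)[r' r'0 hr'] : is_derive t 1 w d by apply: hw; rewrite tc.
  exists (Num.min r r') => [|s]; first by rewrite lt_min r0.
  rewrite lt_min => /andP[h1 h2]; case: ifP => sc; first exact: hr.
  by rewrite vw; exact: hr'.
Qed.

(** The mean value theorem, without an order on the two points. *)
Lemma is_derive_mvt f (df : R -> R) s t : (forall x : R, is_derive x 1 f (df x)) ->
  exists2 x, `|x - t| <= `|s - t| & f s - f t = df x * (s - t).
Proof.
move=> hf.
have cf : continuous f by move=> x; exact: is_derive_continuous (hf x).
have [st|ts] := leP s t.
  have [x] := MVT_segment st (fun x _ => hf x) (continuous_subspaceT cf).
  rewrite in_itv /= => /andP[h1 h2] h3; exists x; last by rewrite -opprB h3; ring.
  by rewrite !ler0_norm ?subr_le0 // lerN2 lerD2r.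
have [x] := MVT_segment (ltW ts) (fun x _ => hf x) (continuous_subspaceT cf).
rewrite in_itv /= => /andP[h1 h2] h3; exists x => //.
by rewrite !ger0_norm ?subr_ge0 ?lerD2r // ltW.
Qed.

End EpsilonDelta.

(** * The interval maps *)

(** Each interval is mapped to its image by a member of a family of
diffeomorphisms [phi_(a, b)] from [0, a] to [0, b] that is closed under
composition, has derivative [1] at both ends, and has derivative close to [1]
everywhere when [a / b] is close to [1].  On the first half of the interval
[phi_(a, b) s = s / (1 + k * s)], with [k = 2 / b - 2 / a] so that the midpoint
goes to the midpoint; the second half is symmetric.  In the coordinate [1 / s] the
map is the translation by [k], and the constants [k] add up: this is why the family
is closed under composition. *)
Section Hump.
Context {R : realType}.
Implicit Types (a b c s t : R).

(** The distance of [s] to the ends of [0, a], and [0] outside. *)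
Definition bdist a s : R := Num.max 0 (Num.min s (a - s)).
(** The constant [k] of the family. *)
Definition curv a b : R := 2 / b - 2 / a.
(** The derivative of [phi_(a, b)] at [s], and [1] outside [0, a]. *)
Definition dens a b s : R := ((1 + curv a b * bdist a s) ^+ 2)^-1.

(** [phi_(a, b) s - s] on the first half of the interval, extended by [0] to
negative arguments. *)
Definition half_hump a b s : R :=
  if s <= 0 then 0 else s / (1 + curv a b * s) - s.

(** [phi_(a, b) s - s], extended to the line by constants. *)
Definition hump a b s : R :=
  if s <= a / 2 then half_hump a b s else b - a - half_hump a b (a - s).

Lemma bdist_ge0 a s : 0 <= bdist a s. Proof. by rewrite le_max lexx. Qed.

Lemma bdist_le a s : 0 < a -> bdist a s <= a / 2.
Proof.
move=> a0; rewrite /bdist ge_max; apply/andP; split; first by lra.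
by rewrite ge_min; have [] := leP s (a / 2) => //= h; lra.
Qed.

Lemma bdist_refl a s : bdist a (a - s) = bdist a s.
Proof. by rewrite /bdist subKr minC. Qed.

Lemma bdistL a s : 0 <= s -> s <= a / 2 -> bdist a s = s.
Proof. move=> s0 sa; rewrite /bdist min_l ?max_r //; lra. Qed.

Lemma bdistR a s : a / 2 <= s -> s <= a -> bdist a s = a - s.
Proof. move=> s0 sa; rewrite -bdist_refl bdistL //; lra. Qed.

Lemma bdist_out a s : s <= 0 \/ a <= s -> bdist a s = 0.
Proof.
move=> h; rewrite /bdist max_l //; rewrite ge_min; apply/orP.
by case: h => h; [left|right; lra].
Qed.

Lemma one_curv_gt0 a b d : 0 < a -> 0 < b -> 0 <= d -> d <= a / 2 ->
  0 < 1 + curv a b * d.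
Proof.
move=> a0 b0 d0 da; rewrite /curv.
have -> : 1 + (2 / b - 2 / a) * d = (1 - 2 * d / a) + 2 * d / b.
  by field; rewrite !gt_eqF.
have h : 2 * d / a <= 1 by rewrite ler_pdivrMr //; lra.
have [->|dn] := eqVneq d 0; first by rewrite mulr0 !mul0r; lra.
have : 0 < 2 * d / b by rewrite divr_gt0 // mulr_gt0 // lt_neqAle eq_sym dn.
lra.
Qed.

Lemma one_curv_bdist_gt0 a b s : 0 < a -> 0 < b -> 0 < 1 + curv a b * bdist a s.
Proof. by move=> a0 b0; apply: one_curv_gt0 => //; [exact: bdist_ge0|exact: bdist_le]. Qed.

Lemma dens_gt0 a b s : 0 < a -> 0 < b -> 0 < dens a b s.
Proof. by move=> a0 b0; rewrite invr_gt0 exprn_gt0 // one_curv_bdist_gt0. Qed.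

Lemma dens_out a b s : s <= 0 \/ a <= s -> dens a b s = 1.
Proof. by move=> h; rewrite /dens bdist_out // mulr0 addr0 expr1n invr1. Qed.

Lemma is_derive_mobius (k t : R) : 1 + k * t != 0 ->
  is_derive t 1 (fun s => s / (1 + k * s) - s) (((1 + k * t) ^+ 2)^-1 - 1).
Proof.
move=> h.
have caff : continuous (fun s : R => 1 + k * s).
  by move=> s; apply: cvgD; [exact: cvg_cst|apply: cvgM; [exact: cvg_cst|exact: cvg_id]].
have -> : ((1 + k * t) ^+ 2)^-1 - 1 = ((1 + k * t) * (1 + k * t))^-1 - 1.
  by rewrite expr2.
apply: (@is_derive_slope _ _ (fun s => ((1 + k * s) * (1 + k * t))^-1 - 1)).
  apply: cvgB; last exact: cvg_cst.
  apply: cvgV; first by rewrite mulf_neq0.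
  by apply: cvgM; [exact: caff|exact: cvg_cst].
have /nbhs_eps[r r0 hr] : \forall s \near t, 1 + k * s != 0.
  exact: (cvgr_neq0 _ (caff t) h).
by apply/nbhs_eps; exists r => // s /hr hs; field; rewrite h hs.
Qed.

Lemma is_derive_half_hump a b t : 0 < a -> 0 < b -> t <= a / 2 ->
  is_derive t 1 (half_hump a b) (dens a b t - 1).
Proof.
move=> a0 b0 ta; apply: is_derive_glue => [t0|t0|]; last by rewrite mul0r subr0.
  by rewrite dens_out ?subrr; [exact: is_derive_cst | left].
rewrite /dens bdistL //; apply: is_derive_mobius.
by rewrite gt_eqF // one_curv_gt0.
Qed.

Lemma half_hump_mid a b : 0 < a -> 0 < b -> half_hump a b (a / 2) = (b - a) / 2.
Proof.
move=> a0 b0; rewrite /half_hump leNgt divr_gt0 //= /curv; field.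
by rewrite !gt_eqF //= ; lra.
Qed.

Lemma half_hump_ge a b s : 0 < a -> 0 < b -> 0 <= s -> s <= a / 2 ->
  half_hump a b s = s / (1 + curv a b * s) - s.
Proof.
move=> a0 b0 s0 sa; rewrite /half_hump; case: ifP => // h.
have -> : s = 0 by lra.
by rewrite mul0r subr0.
Qed.

Lemma is_derive_hump a b t : 0 < a -> 0 < b ->
  is_derive t 1 (hump a b) (dens a b t - 1).
Proof.
move=> a0 b0; apply: is_derive_glue => [ta|ta|]; first exact: is_derive_half_hump.
  have h : is_derive (a - t) 1 (half_hump a b) (dens a b (a - t) - 1).
    by apply: is_derive_half_hump => //; lra.
  apply/is_derive_eps => e e0; have /is_derive_eps/(_ e e0)[r r0 hr] := h.
  exists r => // s st; have := hr (a - s).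
  have -> : a - s - (a - t) = - (s - t) by ring.
  rewrite normrN => /(_ st); rewrite -[X in X <= _ -> _]normrN /dens bdist_refl.
  by congr (`|_| <= _); ring.
have -> : a - a / 2 = a / 2 by lra.
by rewrite half_hump_mid //; lra.
Qed.

Lemma hump_le0 a b s : 0 < a -> s <= 0 -> hump a b s = 0.
Proof.
move=> a0 s0; have sa : s <= a / 2 by lra.
by rewrite /hump sa /half_hump s0.
Qed.

Lemma hump_ge a b s : 0 < a -> a <= s -> hump a b s = b - a.
Proof.
move=> a0 s0; have -> : hump a b s = b - a - half_hump a b (a - s).
  by rewrite /hump ifF //; apply/negbTE; rewrite -ltNge; lra.
have sa : a - s <= 0 by lra.
by rewrite /half_hump sa subr0.
Qed.

(** The formula for [phi_(a, b)]. *)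
Lemma humpE a b s : 0 < a -> 0 < b -> 0 <= s -> s <= a ->
  s + hump a b s = if s <= a / 2 then s / (1 + curv a b * s)
    else b - (a - s) / (1 + curv a b * (a - s)).
Proof.
move=> a0 b0 s0 sa; rewrite /hump; case: ifP => h.
  by rewrite half_hump_ge //; ring.
have h' : a / 2 < s by rewrite ltNge h.
by rewrite half_hump_ge //; [ring|lra|lra].
Qed.

Lemma mobius_range a b d : 0 < a -> 0 < b -> 0 <= d -> d <= a / 2 ->
  0 <= d / (1 + curv a b * d) <= b / 2.
Proof.
move=> a0 b0 d0 da; have h := one_curv_gt0 a0 b0 d0 da.
apply/andP; split; first by rewrite divr_ge0 // ltW.
rewrite ler_pdivrMr // /curv.
have -> : b / 2 * (1 + (2 / b - 2 / a) * d) = b / 2 * (1 - 2 * d / a) + d.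
  by field; rewrite !gt_eqF.
rewrite lerDr mulr_ge0 //; first by rewrite divr_ge0 // ltW.
by rewrite subr_ge0 ler_pdivrMr //; lra.
Qed.

Lemma hump_range a b s : 0 < a -> 0 < b -> 0 <= s -> s <= a ->
  0 <= s + hump a b s <= b.
Proof.
move=> a0 b0 s0 sa; rewrite humpE //; case: ifP => h.
  by have := mobius_range a0 b0 s0 h; lra.
have h' : a / 2 < s by rewrite ltNge h.
have := @mobius_range a b (a - s) a0 b0 ltac:(lra) ltac:(lra); lra.
Qed.

Lemma hump_bound a b s : 0 < a -> 0 < b -> - a <= hump a b s <= b.
Proof.
move=> a0 b0; have [s0|s0] := leP s 0; first by rewrite hump_le0 //; lra.
have [sa|sa] := leP a s; first by rewrite hump_ge //; lra.
by have := hump_range a0 b0 (ltW s0) (ltW sa); lra.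
Qed.

Lemma bdist_hump a b s : 0 < a -> 0 < b -> 0 <= s -> s <= a ->
  bdist b (s + hump a b s) = bdist a s / (1 + curv a b * bdist a s).
Proof.
move=> a0 b0 s0 sa; rewrite humpE //; case: ifP => h.
  have := mobius_range a0 b0 s0 h; rewrite (bdistL s0) //.
  by move=> /andP[h1 h2]; rewrite bdistL.
have h' : a / 2 < s by rewrite ltNge h.
rewrite bdist_refl (bdistR (ltW h') sa).
have := @mobius_range a b (a - s) a0 b0 ltac:(lra) ltac:(lra).
by move=> /andP[h1 h2]; rewrite bdistL.
Qed.

(** The chain rule for [phi_(b, c) o phi_(a, b) = phi_(a, c)]. *)
Lemma dens_comp a b c s : 0 < a -> 0 < b -> 0 < c -> 0 <= s -> s <= a ->
  dens b c (s + hump a b s) * dens a b s = dens a c s.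
Proof.
move=> a0 b0 c0 s0 sa.
have h1 := one_curv_bdist_gt0 s a0 b0; have h2 := one_curv_bdist_gt0 s a0 c0.
have E : curv a c = curv a b + curv b c by rewrite /curv; ring.
rewrite /dens E -invfM -exprMn; congr (_ ^-1); congr (_ ^+ 2).
by rewrite bdist_hump //; field; rewrite gt_eqF.
Qed.

Lemma dens_id a s : dens a a s = 1.
Proof. by rewrite /dens /curv subrr mul0r addr0 expr1n invr1. Qed.

Lemma continuous_bdist a : continuous (bdist a).
Proof.
move=> s; apply/continuous_eps => e e0; exists e => // t ts; apply: ltW.
apply: le_lt_trans ts; rewrite /bdist.
rewrite ler_norml; have := ler_norm (t - s); have := ler_norm (s - t).
rewrite (distrC s t) => h1 h2.
have [hs|hs] := leP s (a - s); have [ht|ht] := leP t (a - t).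
- by have [? | ?] := leP 0 s; have [? | ?] := leP 0 t; apply/andP; split; lra.
- by have [? | ?] := leP 0 s; have [? | ?] := leP 0 (a - t); apply/andP; split; lra.
- by have [? | ?] := leP 0 (a - s); have [? | ?] := leP 0 t; apply/andP; split; lra.
- by have [? | ?] := leP 0 (a - s); have [? | ?] := leP 0 (a - t); apply/andP; split; lra.
Qed.

Lemma continuous_dens a b : 0 < a -> 0 < b -> continuous (dens a b).
Proof.
move=> a0 b0 s; have h := one_curv_bdist_gt0 s a0 b0.
apply: cvgV; first by rewrite expf_neq0 // gt_eqF.
have c1 : {for s, continuous (fun s => 1 + curv a b * bdist a s)}.
  apply: cvgD; first exact: cvg_cst.
  by apply: cvgM; [exact: cvg_cst|exact: continuous_bdist].
exact: cvgM.
Qed.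

Lemma dens_near1 a b e s : 0 < a -> 0 < b -> 0 < e -> e <= 1 ->
  b <= (1 + e) * a -> a <= (1 + e) * b -> `|dens a b s - 1| <= 3 * e.
Proof.
move=> a0 b0 e0 e1 ba ab.
set d := bdist a s; set D := 1 + curv a b * d.
have d0 : 0 <= d := bdist_ge0 a s.
have da : d <= a / 2 := bdist_le s a0.
have D0 : 0 < D := one_curv_bdist_gt0 s a0 b0.
have DE : D = 1 + (a / b - 1) * (2 * d / a).
  by rewrite /D /curv; field; rewrite !gt_eqF.
set y := 2 * d / a in DE.
have y0 : 0 <= y by rewrite divr_ge0 ?mulr_ge0 // ltW.
have y1 : y <= 1 by rewrite ler_pdivrMr //; lra.
have r1 : a / b <= 1 + e by rewrite ler_pdivrMr.
have r2 : 1 <= (1 + e) * (a / b) by rewrite mulrA ler_pdivlMr ?mul1r.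
have D1 : D <= 1 + e by rewrite DE; nra.
have D2 : 1 <= (1 + e) * D.
  rewrite DE; set q := a / b in r2 *.
  have := ler_wpM2l y0 r2; have : 0 <= e * (1 - y) by rewrite mulr_ge0; lra.
  by move=> h1 h2; nra.
rewrite /dens -/d -/D.
have DD : 0 < D ^+ 2 by rewrite exprn_gt0.
rewrite ler_norml; apply/andP; split.
  rewrite lerBrDr -[X in _ <= X]mul1r ler_pdivlMr //.
  have D12 : D ^+ 2 <= (1 + e) ^+ 2 by rewrite lerXn2r // nnegrE; lra.
  have [h|h] := leP 0 (1 - 3 * e).
    have h1 : (- (3 * e) + 1) * D ^+ 2 <= (1 - 3 * e) * (1 + e) ^+ 2.
      by rewrite addrC ler_wpM2l.
    apply: (le_trans h1); have : 0 <= e ^+ 2 by exact: sqr_ge0.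
    have : 0 <= e ^+ 3 by rewrite exprn_ge0 // ltW.
    by rewrite !exprS expr0; nra.
  apply: (@le_trans _ _ 0) => //; rewrite mulr_le0_ge0 //; [lra|exact: ltW].
rewrite lerBlDr -[X in X <= _]mul1r ler_pdivrMr //.
have D22 : 1 <= ((1 + e) * D) ^+ 2 by rewrite exprn_ege1.
apply: (le_trans D22); rewrite exprMn ler_wpM2r //; first exact: ltW.
by rewrite expr2; nra.
Qed.

End Hump.

Section HumpInverse.
Context {R : realType}.

Lemma humpR (a b s : R) : 0 < a -> 0 < b -> a / 2 <= s -> s <= a ->
  s + hump a b s = b - (a - s) / (1 + curv a b * (a - s)).
Proof.
move=> a0 b0 s1 s2; rewrite humpE //; last by lra.
case: ifP => // h; have -> : s = a / 2 by lra.
have -> : a - a / 2 = a / 2 by lra.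
have h1 : 0 < 1 + curv a b * (a / 2) by apply: one_curv_gt0 => //; lra.
have -> : 1 + curv a b * (a / 2) = a / b by rewrite /curv; field; rewrite !gt_eqF.
by field; rewrite !gt_eqF.
Qed.

Lemma mobiusK (a b d : R) : 0 < a -> 0 < b -> 0 <= d -> d <= b / 2 ->
  let v := d / (1 + curv b a * d) in v / (1 + curv a b * v) = d.
Proof.
move=> a0 b0 d0 da /=; have h := one_curv_gt0 b0 a0 d0 da.
have -> : curv a b = - curv b a by rewrite /curv; ring.
by field; rewrite mulNr addrK oner_neq0 gt_eqF.
Qed.

(** The maps [phi_(b, a)] and [phi_(a, b)] are inverse to each other. *)
Lemma humpK (a b s : R) : 0 < a -> 0 < b -> 0 <= s -> s <= b ->
  let d := s + hump b a s in d + hump a b d = s.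
Proof.
move=> a0 b0 s0 sb; have [h|h] := leP s (b / 2).
  rewrite /= (humpE b0) // h.
  have /andP[h1 h2] := mobius_range b0 a0 s0 h.
  by rewrite (humpE a0) //; [rewrite h2 mobiusK | lra].
rewrite /= (humpR b0) //; last exact: ltW.
have s1 : 0 <= b - s by lra.
have s2 : b - s <= b / 2 by lra.
have /andP[h1 h2] := mobius_range b0 a0 s1 s2.
rewrite (humpR a0) //; [|lra|lra].
by rewrite subKr mobiusK // subKr.
Qed.

End HumpInverse.

(** * Blowing up an orbit *)

(** Termwise differentiation: [U] is the pointwise sum of the functions [u y] and
[Q] the uniform sum of their derivatives [q y]. *)
Lemma is_derive_termwise (R : realType) (X : choiceType) (u q : X -> R -> R)
    (U Q : R -> R) :
  (forall y (t : R), is_derive t 1 (u y) (q y t)) -> (forall y, continuous (q y)) ->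
  (forall t e, 0 < e -> exists E0 : {fset X}, forall E : {fset X},
     {subset E0 <= E} -> `|U t - \sum_(y <- E) u y t| <= e) ->
  (forall e, 0 < e -> exists E0 : {fset X}, forall E : {fset X},
     {subset E0 <= E} -> forall t, `|Q t - \sum_(y <- E) q y t| <= e) ->
  continuous Q /\ forall t : R, is_derive t 1 U (Q t).
Proof.
move=> du cq hU hQ.
have dS (E : seq X) (t : R) :
    is_derive t 1 (fun s => \sum_(y <- E) u y s) (\sum_(y <- E) q y t).
  elim: E => [|y E IH].
    under eq_fun do rewrite big_nil.
    by rewrite big_nil; exact: is_derive_cst.
  under eq_fun do rewrite big_cons.
  by rewrite big_cons; exact: (is_deriveD (du y t) IH).
have cS (E : seq X) : continuous (fun s => \sum_(y <- E) q y s).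
  move=> t; elim: E => [|y E IH].
    under eq_fun do rewrite big_nil.
    exact: cvg_cst.
  under eq_fun do rewrite big_cons.
  exact: (cvgD (cq y t) IH).
have cQ : continuous Q.
  move=> t; apply/continuous_eps => e e0.
  have e30 : 0 < e / 3 by rewrite divr_gt0.
  have [E hE] := hQ _ e30.
  have /continuous_eps/(_ _ e30)[r r0 hr] := cS E t.
  exists r => // s /hr; have := hE E (fun x xE => xE) s; have := hE E (fun x xE => xE) t.
  rewrite !ler_norml; lra.
split=> // t; apply/is_derive_eps => e e0.
have e20 : 0 < e / 2 by rewrite divr_gt0.
have [E1 hE1] := hQ _ e20.
have /continuous_eps/(_ _ e20)[r r0 hr] := cQ t.
exists r => // s st; apply/ler_addgt0Pr => d d0.
have d20 : 0 < d / 2 by rewrite divr_gt0.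
have [E2 hE2] := hU s _ d20; have [E3 hE3] := hU t _ d20.
pose E := (E1 `|` (E2 `|` E3))%fset.
have /hE1 h1 : {subset E1 <= E} by move=> y h; rewrite !in_fsetU h.
have /hE2 : {subset E2 <= E} by move=> y h; rewrite !in_fsetU h orbT.
have /hE3 : {subset E3 <= E} by move=> y h; rewrite !in_fsetU h !orbT.
(* On the finite set E, apply the mean value theorem to the partial sum. *)
have [x xt] := is_derive_mvt s t (dS E).
set Us := \sum_(y <- E) u y s; set Ut := \sum_(y <- E) u y t => hx.
have hq : `|\sum_(y <- E) q y x - Q t| <= e.
  have := h1 x; have := hr x (le_lt_trans xt st).
  rewrite !ler_norml; lra.
have : `|(\sum_(y <- E) q y x - Q t) * (s - t)| <= e * `|s - t|.
  by rewrite normrM ler_wpM2r.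
rewrite mulrBl -hx; set w := e * _; set z := Q t * _.
rewrite !ler_norml; lra.
Qed.

(** The points [x] are blown up to the intervals [p x, p x + l x] of [0, 1], laid
out in the order of [p], where [p x] is the total length of the intervals that
precede that of [x].  A bijection [s] that distorts lengths by a factor tending to
[1] moves the interval of [x] to that of [s x] by the map [phi_(l x, l (s x))]. *)
Section Arrangement.
Context {R : realType} {X : choiceType} (l p : X -> R).
Hypothesis l_gt0 : forall x, 0 < l x.
Hypothesis l_bounded : tbounded l.
Hypothesis l_sum : tsum l = 1.
Hypothesis p_inj : injective p.
Hypothesis pE : forall x, p x = tsum (fun y => (p y < p x)%R%:R * l y).

Let mask_le (P : pred X) y : 0 <= (P y)%:R * l y <= l y.
Proof. by case: (P y); rewrite ?mul1r ?mul0r ?lexx ?ltW. Qed.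

(** The intervals do not overlap. *)
Lemma position_sep x y : p x < p y -> p x + l x <= p y.
Proof.
move=> xy; rewrite [p x]pE [p y]pE -[l x](tsum_mask1 x l_bounded) -tsumD.
- apply: ler_tsum; first exact: tbounded_mask.
  move=> z; have lz := ltW (l_gt0 z); have [->|zx] := eqVneq z x.
    by rewrite ltxx xy mul0r add0r !mul1r lexx andbT ltW.
  rewrite mul0r addr0; have [zx'|_] := boolP (p z < p x).
    by rewrite (lt_trans zx' xy) mul1r lexx andbT.
  by rewrite mul0r lexx mulr_ge0.
- exact: tbounded_mask.
- exact: (tbounded_mask (pred1 x)).
Qed.

Lemma position_ge0 x : 0 <= p x.
Proof. by rewrite pE tsum_ge0 //; exact: tbounded_mask. Qed.

Lemma position_le1 x : p x + l x <= 1.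
Proof.
rewrite -[leRHS]l_sum [p x]pE -[l x](tsum_mask1 x l_bounded) -tsumD.
- apply: ler_tsum => // z; have lz := ltW (l_gt0 z); have [->|zx] := eqVneq z x.
    by rewrite ltxx mul0r add0r mul1r lexx andbT ltW.
  by rewrite mul0r addr0; have /andP[-> ->] := mask_le (fun z => p z < p x) z.
- exact: tbounded_mask.
- exact: (tbounded_mask (pred1 x)).
Qed.

Lemma position_uniq x y t : 0 < t - p x < l x -> 0 < t - p y < l y -> x = y.
Proof.
move=> h1 h2; apply: p_inj.
have [/position_sep|/position_sep|//] := ltgtP (p x) (p y); lra.
Qed.

Variables (s s' : X -> X).
Hypothesis sK : cancel s s'.
Hypothesis s'K : cancel s' s.
Hypothesis s_ratio : forall e, 0 < e -> exists E : {fset X}, forall x, x \notin E ->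
  l (s x) <= (1 + e) * l x /\ l x <= (1 + e) * l (s x).

(** The contribution of [y] to the displacement, and its derivative. *)
Let u y t : R := hump (l y) (l (s y)) (t - p y).
Let q y t : R := dens (l y) (l (s y)) (t - p y) - 1.

(** The sum of the signed family [u], made nonnegative by adding the lengths,
whose sum is [1]. *)
Definition shift (t : R) : R := tsum (fun y => u y t + l y) - 1.

(** The derivative of [shift]: at most one term of the sum of the [q y t] is
nonzero, and it is selected by choice. *)
Definition slope (t : R) : R :=
  match pselect (exists y, 0 < t - p y < l y) with
  | left h => q (projT1 (cid h)) t | right _ => 0 end.

Let q_out y t : ~ 0 < t - p y < l y -> q y t = 0.
Proof.
move=> h; rewrite /q dens_out ?subrr //.
have [?|h1] := leP (t - p y) 0; first by left.
by right; rewrite leNgt; apply/negP => h2; apply: h; rewrite h1.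
Qed.

Let slopeE x t : 0 <= t - p x <= l x -> slope t = q x t.
Proof.
move=> tx; rewrite /slope; case: pselect => h.
  case: cid => y /= hy; suff -> : x = y by [].
  apply: p_inj; have [/position_sep|/position_sep|//] := ltgtP (p x) (p y); lra.
by rewrite q_out // => h'; apply: h; exists x.
Qed.

Lemma slope_dens x d : 0 <= d <= l x -> slope (p x + d) = dens (l x) (l (s x)) d - 1.
Proof.
have e : p x + d - p x = d by rewrite addrC addKr.
by move=> h; rewrite (@slopeE x) /q e.
Qed.

Lemma slope_off t : (forall x, ~ 0 < t - p x < l x) -> slope t = 0.
Proof. by move=> h; rewrite /slope; case: pselect => // -[x hx]; case: (h x). Qed.

Lemma slope_out t : t <= 0 \/ 1 <= t -> slope t = 0.
Proof.
move=> h; apply: slope_off => x; have := position_ge0 x; have := position_le1 x.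
by case: h => h h1 h2 /andP[h3 h4]; lra.
Qed.

Lemma slope_gt t : 0 < 1 + slope t.
Proof.
rewrite /slope; case: pselect => [h|_]; last by rewrite addr0.
by rewrite /q addrC subrK dens_gt0.
Qed.

Let q_sum (E : {fset X}) x t : 0 < t - p x < l x ->
  \sum_(y <- E) q y t = if x \in E then q x t else 0.
Proof.
move=> hx; case: ifP => xE.
  rewrite (big_fsetD1 x) //= big_seq big1 ?addr0 // => y.
  rewrite !inE => /andP[/eqP yx _]; apply: q_out => hy; apply: yx.
  exact: position_uniq hy hx.
rewrite big_seq big1 // => y yE; apply: q_out => hy.
by move: xE; rewrite (position_uniq hx hy) yE.
Qed.

Let q_small e : 0 < e -> exists E0 : {fset X}, forall y, y \notin E0 -> forall t, `|q y t| <= e.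
Proof.
move=> e0; have d0 : 0 < Num.min (e / 3) 1 by rewrite lt_min ltr01 andbT divr_gt0.
have [E hE] := s_ratio d0; exists E => y /hE[h1 h2] t.
have d1 : Num.min (e / 3) 1 <= 1 by rewrite ge_min lexx orbT.
have d2 : Num.min (e / 3) 1 <= e / 3 by rewrite ge_min lexx.
apply: le_trans (dens_near1 _ (l_gt0 _) (l_gt0 _) d0 d1 h1 h2) _; lra.
Qed.

Let slope_approx e : 0 < e -> exists E0 : {fset X}, forall E : {fset X},
  {subset E0 <= E} -> forall t, `|slope t - \sum_(y <- E) q y t| <= e.
Proof.
move=> e0; have [E0 hE0] := q_small e0; exists E0 => E sE t.
have [[x hx]|h] := pselect (exists x, 0 < t - p x < l x).
  have hx' : 0 <= t - p x <= l x by lra.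
  rewrite (q_sum _ hx) (slopeE hx'); case: ifP => xE; first by rewrite subrr normr0 ltW.
  rewrite subr0; apply: hE0; apply: contraFN xE; exact: sE.
rewrite slope_off => [|x hx]; last by apply: h; exists x.
rewrite big1 ?subrr ?normr0 ?ltW // => y _; apply: q_out => hy; apply: h.
by exists y.
Qed.

Let ls_bounded : tbounded (l \o s).
Proof. exact: tbounded_inj (can_inj sK) l_bounded. Qed.

Let w_bounded t : tbounded (fun y => u y t + l y).
Proof.
apply: (@tbounded_le _ _ _ (fun y => l (s y) + l y)); first exact: tboundedD.
move=> y; have := hump_bound (t - p y) (l_gt0 y) (l_gt0 (s y)); rewrite /u; lra.
Qed.

Let shift_approx t e : 0 < e -> exists E0 : {fset X}, forall E : {fset X},
     {subset E0 <= E} -> `|shift t - \sum_(y <- E) u y t| <= e.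
Proof.
move=> e0.
have [E1 hE1] := tsum_approx (w_bounded t) e0.
have [E2 hE2] := tsum_approx l_bounded e0.
exists (E1 `|` E2)%fset => E sE.
have := hE1 E (fun y h => sE y (introT (fsetUP _ _ _) (or_introl h))).
have := hE2 E (fun y h => sE y (introT (fsetUP _ _ _) (or_intror h))).
rewrite big_split /= l_sum /shift ler_norml; lra.
Qed.

Lemma shift_derive : continuous slope /\ forall t : R, is_derive t 1 shift (slope t).
Proof.
apply: (is_derive_termwise (u := u) (q := q)) => //.
  move=> y t; have := is_derive_hump (t - p y) (l_gt0 y) (l_gt0 (s y)).
  move=> /is_derive_eps h; apply/is_derive_eps => e /h[r r0 hr]; exists r => // x hx.
  have := hr (x - p y); have -> : x - p y - (t - p y) = x - t by ring.
  exact.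
move=> y t; have cd := continuous_dens (l_gt0 y) (l_gt0 (s y)).
have := cd (t - p y).
move=> /continuous_eps h; apply/continuous_eps => e /h[r r0 hr]; exists r => // x hx.
rewrite /q; have := hr (x - p y); have -> : x - p y - (t - p y) = x - t by ring.
move=> /(_ hx); congr (`|_| <= _); ring.
Qed.

Lemma shift_le0 t : t <= 0 -> shift t = 0.
Proof.
move=> t0; rewrite /shift (@eq_tsum _ _ _ l) ?l_sum ?subrr // => y.
rewrite /u hump_le0 ?add0r //; have := position_ge0 y; lra.
Qed.

(** The total length is invariant under [s]. *)
Lemma shift_ge1 t : 1 <= t -> shift t = 0.
Proof.
move=> t1; rewrite /shift (@eq_tsum _ _ _ (l \o s)).
  by rewrite (tsum_bij sK s'K) // l_sum subrr.
move=> y; rewrite /u hump_ge ?subrK //; have := position_le1 y; lra.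
Qed.

(** The points before [x] contribute the lengths of their images, and those after
[x] nothing. *)
Lemma shiftE x d : 0 <= d <= l x -> p x + d + shift (p x + d) =
  tsum (fun y => (p y < p x)%R%:R * l (s y)) + (d + hump (l x) (l (s x)) d).
Proof.
move=> hd; set t := p x + d.
have e : t - p x = d by rewrite /t addrC addKr.
pose T := tsum (fun y => (p x < p y)%R%:R * l y).
(* T is the total length of the intervals after that of x. *)
have hT : 1 = p x + l x + T.
  rewrite -l_sum [p x]pE -[l x](tsum_mask1 x l_bounded) -!tsumD; first last.
  - exact: (tbounded_mask (pred1 x)).
  - exact: tbounded_mask.
  - exact: tbounded_mask.
  - by apply: tboundedD; [exact: tbounded_mask|exact: (tbounded_mask (pred1 x))].
  apply: eq_tsum => y; have [->|yx] := eqVneq y x; first by rewrite ltxx /= mulr1n mulr0n; ring.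
  have : p y != p x by apply: contra yx => /eqP/p_inj ->.
  by have [h|h|//] := ltgtP (p y) (p x) => _; rewrite /= ?mulr1n ?mulr0n; ring.
have hW : tsum (fun y => u y t + l y) =
    tsum (fun y => (p y < p x)%R%:R * l (s y)) + (u x t + l x) + T.
  rewrite -(tsum_mask1 x (w_bounded t)) -!tsumD; first last.
  - exact: (tbounded_mask (pred1 x) (w_bounded t)).
  - exact: (tbounded_mask (fun y => p y < p x) ls_bounded).
  - exact: tbounded_mask.
  - apply: tboundedD; first exact: (tbounded_mask (fun y => p y < p x) ls_bounded).
    exact: (tbounded_mask (pred1 x) (w_bounded t)).
  apply: eq_tsum => y; have [->|yx] := eqVneq y x; first by rewrite ltxx /= mulr1n mulr0n; ring.
  have : p y != p x by apply: contra yx => /eqP/p_inj ->.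
  have [/position_sep h|/position_sep h|//] := ltgtP (p y) (p x) => _.
    by rewrite /u hump_ge //= ?mulr1n ?mulr0n; [ring|rewrite /t; lra].
  by rewrite /u hump_le0 //= ?mulr1n ?mulr0n; [ring|rewrite /t; lra].
by rewrite /shift hW /u e {1}/t; lra.
Qed.

End Arrangement.

(** * Periodisation *)

Section Periodise.
Context {R : realType}.
Implicit Types (t : R) (m : int).

(** The fractional part, in [0, 1). *)
Definition frac t : R := t - (Num.floor t)%:~R.

Lemma frac_itv t : 0 <= frac t < 1.
Proof.
have := floor_itv t; rewrite intrD1 /frac; lra.
Qed.

Lemma fracDz t m : frac (t + m%:~R) = frac t.
Proof. by rewrite /frac floorDrz // intrKfloor intrD; ring. Qed.

Lemma frac_id t : 0 <= t < 1 -> frac t = t.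
Proof. by move=> h; rewrite /frac (@floor_def _ t 0) ?subr0 // add0r. Qed.

(** Periodisation of a function [V] that vanishes outside the open unit interval. *)
Section Functions.
Variable V : R -> R.
Hypothesis V_out : forall t, t <= 0 \/ 1 <= t -> V t = 0.

Lemma frac_extend t : 0 <= t <= 1 -> V (frac t) = V t.
Proof.
move=> /andP[t0]; rewrite le_eqVlt => /predU1P[->|t1]; last by rewrite frac_id ?t0.
rewrite (_ : 1 = 0 + 1%:~R :> R); last by rewrite add0r.
rewrite fracDz frac_id ?lexx ?ltr01 // !V_out //; last by left.
by right; rewrite add0r.
Qed.

(** Near [t] the periodisation is the sum of two translates of [V]; the second
one matters to the left of the integer part of [t]. *)
Lemma frac_local t x : `|x - t| < 1 - frac t ->
  V (frac x) = V (x - (Num.floor t)%:~R) + V (x - (Num.floor t)%:~R + 1).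
Proof.
rewrite ltr_distl => /andP[h1 h2]; have /andP[f0 f1] := frac_itv t.
set n := Num.floor t; have nt : n%:~R = t - frac t by rewrite /frac -/n; ring.
have [h|h] := leP n%:~R x.
  rewrite (@V_out (x - _ + 1)) ?addr0; last by right; lra.
  rewrite -(fracDz x (- n)) frac_id; last first.
    by rewrite mulrNz; lra.
  by rewrite mulrNz.
rewrite (@V_out (x - n%:~R)) ?add0r; last by left; lra.
rewrite -(fracDz x (- n + 1)) frac_id; last first.
  by rewrite intrD1 mulrNz; lra.
by rewrite intrD1 mulrNz addrA.
Qed.

Lemma frac_continuous : continuous V -> continuous (V \o frac).
Proof.
move=> cV t; have /andP[f0 f1] := frac_itv t.
set n : R := (Num.floor t)%:~R.
apply/continuous_eps => e e0; have e20 : 0 < e / 2 by rewrite divr_gt0.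
have /continuous_eps/(_ _ e20)[r r0 hr] := cV (t - n).
have /continuous_eps/(_ _ e20)[r' r'0 hr'] := cV (t - n + 1).
exists (Num.min (1 - frac t) (Num.min r r')) => [|x].
  by rewrite !lt_min r0 r'0 subr_gt0 f1.
rewrite !lt_min => /and3P[h1 h2 h3].
have /(frac_local) E : `|t - t| < 1 - frac t by rewrite subrr normr0 subr_gt0.
rewrite /= (frac_local h1) E -/n.
have := hr (x - n); have := hr' (x - n + 1).
have -> : x - n + 1 - (t - n + 1) = x - t by ring.
have -> : x - n - (t - n) = x - t by ring.
move=> /(_ h3) + /(_ h2); rewrite !ler_norml; lra.
Qed.

Lemma frac_derive (dV : R -> R) t : (forall x : R, is_derive x 1 V (dV x)) ->
  is_derive t 1 (V \o frac) (dV (t - (Num.floor t)%:~R) + dV (t - (Num.floor t)%:~R + 1)).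
Proof.
move=> hV; have /andP[f0 f1] := frac_itv t.
set n : R := (Num.floor t)%:~R.
apply/is_derive_eps => e e0; have e20 : 0 < e / 2 by rewrite divr_gt0.
have /is_derive_eps/(_ _ e20)[r r0 hr] := hV (t - n).
have /is_derive_eps/(_ _ e20)[r' r'0 hr'] := hV (t - n + 1).
exists (Num.min (1 - frac t) (Num.min r r')) => [|x].
  by rewrite !lt_min r0 r'0 subr_gt0 f1.
rewrite !lt_min => /and3P[h1 h2 h3].
have /(frac_local) E : `|t - t| < 1 - frac t by rewrite subrr normr0 subr_gt0.
rewrite /= (frac_local h1) E -/n.
have := hr (x - n); have := hr' (x - n + 1).
have -> : x - n + 1 - (t - n + 1) = x - t by ring.
have -> : x - n - (t - n) = x - t by ring.
move=> /(_ h3) + /(_ h2); rewrite mulrDl [_ * `|_|]mulrAC.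
set A := dV _ * _; set B := dV _ * _; set C := e * _; rewrite !ler_norml; lra.
Qed.

End Functions.
End Periodise.

(** * Lifting the action to the line *)

(** With the notation of the blown-up intervals, each [g] acts on [R / Z] through
the lift [lift g].  The constant [c g] is the position of the image of [0]; the
hypothesis on it says that [lift g] sends the left end of the interval of [x] to
that of [a g x], modulo integers. *)
Section Realization.
Context {R : realType} {G : groupType} {X : choiceType}.
Variables (l p : X -> R) (a : G -> X -> X) (c : G -> R) (x0 : X).
Hypothesis l_gt0 : forall x, 0 < l x.
Hypothesis l_bounded : tbounded l.
Hypothesis l_sum : tsum l = 1.
Hypothesis p_inj : injective p.
Hypothesis pE : forall x, p x = tsum (fun y => (p y < p x)%R%:R * l y).
Hypothesis a_act : is_left_action a.
Hypothesis l_ratio : forall g (e : R), 0 < e -> exists E : {fset X},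
  forall x, x \notin E -> l (a g x) <= (1 + e) * l x.
Hypothesis c_int : forall g x,
  c g + tsum (fun y => (p y < p x)%R%:R * l (a g y)) - p (a g x) \is a Num.int.

Let aK g : cancel (a g) (a (g^-1)%g).
Proof. by move: a_act => [a1 aM] x; rewrite -aM mulVg a1. Qed.

Let aVK g : cancel (a (g^-1)%g) (a g).
Proof. by move: a_act => [a1 aM] x; rewrite -aM mulgV a1. Qed.

Let ratio2 g (e : R) : 0 < e -> exists E : {fset X}, forall x, x \notin E ->
  l (a g x) <= (1 + e) * l x /\ l x <= (1 + e) * l (a g x).
Proof.
move=> e0; have [E hE] := l_ratio g e0; have [E' hE'] := l_ratio (g^-1)%g e0.
exists (E `|` [fset a (g^-1)%g x | x in E'])%fset => x.
rewrite in_fsetU negb_or => /andP[/hE h1 h2]; split=> //.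
rewrite -{1}(aK g x); apply: hE'; apply: contra h2 => h.
by apply/imfsetP; exists (a g x); rewrite ?aK.
Qed.

(** A homeomorphism of the line that commutes with integer translations. *)
Definition lift g (t : R) : R := c g + t + shift l p (a g) (frac t).
(** The derivative of [lift g]. *)
Definition lift_deriv g (t : R) : R := 1 + slope l p (a g) (frac t).

Let shift_out g t : t <= 0 \/ 1 <= t -> shift l p (a g) t = 0.
Proof.
by case=> h; [exact: shift_le0 | exact: (shift_ge1 _ _ _ _ (aK g) (aVK g))].
Qed.

Let slope_outg g t : t <= 0 \/ 1 <= t -> slope l p (a g) t = 0.
Proof. exact: slope_out. Qed.

Lemma lift_derivP g (t : R) : is_derive t 1 (lift g) (lift_deriv g t).
Proof.
have [_ hd] := shift_derive l_gt0 l_bounded l_sum p_inj pE (aK g) (ratio2 g).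
have := frac_derive (@shift_out g) t hd.
have /andP[f0 f1] := frac_itv t.
rewrite (@slope_outg g (t - _ + 1)); last by right; rewrite -/(frac t); lra.
rewrite addr0 -/(frac t) => h.
have h1 : is_derive t 1 (fun s : R => c g + s) 1.
  apply/is_derive_eps => e e0; exists 1 => // s _.
  have -> : c g + s - (c g + t) - 1 * (s - t) = 0 by ring.
  by rewrite normr0 mulr_ge0 // ltW.
exact: (is_deriveD h1 h).
Qed.

Lemma lift_deriv_continuous g : continuous (lift_deriv g).
Proof.
have [hc _] := shift_derive l_gt0 l_bounded l_sum p_inj pE (aK g) (ratio2 g).
move=> t; apply: cvgD; first exact: cvg_cst.
exact: (frac_continuous (@slope_outg g) hc).
Qed.

Lemma lift_deriv_gt0 g t : 0 < lift_deriv g t.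
Proof. exact: slope_gt. Qed.

Lemma liftDz g t (m : int) : lift g (t + m%:~R) = lift g t + m%:~R.
Proof. by rewrite /lift fracDz; ring. Qed.

Lemma lift_derivDz g t (m : int) : lift_deriv g (t + m%:~R) = lift_deriv g t.
Proof. by rewrite /lift_deriv fracDz. Qed.

Lemma lift0 g : lift g 0 = c g.
Proof. by rewrite /lift frac_id ?lexx ?ltr01 // shift_out ?addr0 //; left. Qed.

Lemma lift_mono g : {homo lift g : s t / s < t}.
Proof.
move=> s t st; rewrite -subr_gt0.
have [x _ ->] := is_derive_mvt t s (lift_derivP g).
by rewrite mulr_gt0 ?lift_deriv_gt0 // subr_gt0.
Qed.

(** On the interval of [x], [lift g] is the interval map onto that of [a g x]. *)
Lemma lift_itv g x d : 0 <= d <= l x ->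
  lift g (p x + d) - (p (a g x) + (d + hump (l x) (l (a g x)) d)) \is a Num.int.
Proof.
move=> hd; rewrite /lift frac_extend; last 2 first.
- exact: shift_out.
- have := position_ge0 l_bounded pE x.
  by have := position_le1 l_gt0 l_bounded l_sum pE x; lra.
have := shiftE l_gt0 l_bounded l_sum p_inj pE (aK g) hd.
have := c_int g x; set P := tsum _; set h := hump _ _ _ => hP hs.
rewrite (_ : _ - _ = c g + P - p (a g x)) //; lra.
Qed.

Lemma lift_deriv_itv g x d : 0 <= d <= l x ->
  lift_deriv g (p x + d) = dens (l x) (l (a g x)) d.
Proof.
move=> hd; rewrite /lift_deriv frac_extend; last 2 first.
- exact: slope_outg.
- have := position_ge0 l_bounded pE x.
  by have := position_le1 l_gt0 l_bounded l_sum pE x; lra.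
by rewrite (slope_dens l_gt0 l_bounded p_inj pE) // addrC subrK.
Qed.

Lemma lift_point g x : lift g (p x) - p (a g x) \is a Num.int.
Proof.
have := @lift_itv g x 0; rewrite hump_le0 // !addr0; apply.
by rewrite lexx ltW.
Qed.

(** The points that lie in the interval of some [x], up to integers. *)
Let inside t := exists x d (m : int), 0 <= d <= l x /\ t = p x + d + m%:~R.

Let lift_deriv_outside g t : ~ inside t -> lift_deriv g t = 1.
Proof.
move=> h; rewrite /lift_deriv slope_off ?addr0 // => x hx; apply: h.
exists x, (frac t - p x), (Num.floor t); split; first by lra.
by rewrite /frac; ring.
Qed.

Let lift_inside g t : inside (lift g t) -> inside t.
Proof.
move=> [z [d [m [hd ht]]]].
have gz : a g (a (g^-1)%g z) = z := aVK g z.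
set x := a (g^-1)%g z in gz.
set d' := d + hump (l z) (l x) d.
have /andP[d0 dl] := hd.
have hd' : 0 <= d' <= l x by exact: hump_range.
have := @lift_itv g x d' hd'; rewrite gz humpK // => /intrP[k hk].
exists x, d', (m - k); split=> //.
have : lift g t = lift g (p x + d' + (m - k)%:~R).
  by rewrite liftDz intrD mulrNz -hk ht; ring.
have [/(lift_mono g)|/(lift_mono g)|//] := ltgtP t (p x + d' + (m - k)%:~R);
  by rewrite ltNge => /negP + E; case; rewrite E.
Qed.

(** Inside the intervals this is the chain rule for the interval maps; outside,
all the derivatives are [1]. *)
Lemma lift_deriv_comp g h t :
  lift_deriv g (lift h t) * lift_deriv h t = lift_deriv (g * h)%g t.
Proof.
have [[x [d [m [hd ->]]]]|nt] := pselect (inside t); last first.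
  rewrite !(@lift_deriv_outside _ t) // lift_deriv_outside ?mulr1 //.
  by move=> /lift_inside.
rewrite liftDz !lift_derivDz !lift_deriv_itv //.
have /intrP[k hk] := lift_itv h hd.
rewrite (_ : lift h (p x + d) = p (a h x) + (d + hump (l x) (l (a h x)) d) + k%:~R); last first.
  by rewrite -hk; ring.
have /andP[d0 dl] := hd.
rewrite lift_derivDz lift_deriv_itv; last exact: hump_range.
by rewrite dens_comp // (proj2 a_act).
Qed.

(** Both sides have the same derivative, so their difference is constant; at
[p x0] it is an integer. *)
Lemma lift_comp g h : exists m : int, forall t, lift g (lift h t) = lift (g * h)%g t + m%:~R.
Proof.
pose K t := lift g (lift h t) - lift (g * h)%g t.
have hK : forall t, K t = K (p x0).
  move=> t; apply: is_derive_0_is_cst => s.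
  have := is_deriveB (is_derive1_comp (lift_derivP g (lift h s)) (lift_derivP h s))
    (lift_derivP (g * h)%g s).
  by rewrite lift_deriv_comp subrr.
have /intrP[m hm] : K (p x0) \is a Num.int.
  have /intrP[k hk] := lift_point h x0.
  have h1 := lift_point g (a h x0).
  have h2 := lift_point (g * h)%g x0.
  have -> : K (p x0) = (lift g (p (a h x0)) - p (a g (a h x0))) + k%:~R -
      (lift (g * h)%g (p x0) - p (a (g * h)%g x0)).
    rewrite /K (proj2 a_act) (_ : lift h (p x0) = p (a h x0) + k%:~R).
      by rewrite liftDz; ring.
    by rewrite -hk; ring.
  by rewrite rpredB // rpredD // intr_int.
by exists m => t; rewrite -hm -(hK t) /K; ring.
Qed.

Lemma lift_1 : exists m : int, forall t, lift 1%g t = t + m%:~R.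
Proof.
have hK : forall t, lift 1%g t - t = lift 1%g (p x0) - p x0.
  move=> t; apply: (@is_derive_0_is_cst _ (fun t => lift 1%g t - t)) => s.
  have h : lift_deriv 1%g s = 1.
    have [[x [d [m [hd ->]]]]|nt] := pselect (inside s); last exact: lift_deriv_outside.
    by rewrite lift_derivDz lift_deriv_itv // (proj1 a_act) dens_id.
  have := is_deriveB (lift_derivP 1%g s) (is_derive_id s 1).
  by rewrite h subrr.
have := lift_point 1%g x0; rewrite (proj1 a_act) => /intrP[m hm].
by exists m => t; rewrite -hm -(hK t); ring.
Qed.

End Realization.

(** * Circular orders *)

Section CircularOrder.
Context {X : choiceType} (c : X -> X -> X -> int).
Hypothesis c_circ : is_circular_order c.

Lemma circ12 x y : c x x y = 0.
Proof. by apply/(circ_eq0 c_circ); apply: Or31. Qed.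

Lemma circ13 x y : c x y x = 0.
Proof. by apply/(circ_eq0 c_circ); apply: Or32. Qed.

Lemma circ23 x y : c x y y = 0.
Proof. by apply/(circ_eq0 c_circ); apply: Or33. Qed.

Lemma circ_swap23 x y z : c x z y = - c x y z.
Proof.
have := circ_cocycle c_circ x y z y; rewrite circ13 circ23 => h.
by apply/eqP; rewrite -subr_eq0 opprK -oppr_eq0; apply/eqP; rewrite -h; ring.
Qed.

Lemma circ_swap12 x y z : c y x z = - c x y z.
Proof.
have := circ_cocycle c_circ x y x z; rewrite circ13 circ12 => h.
by apply/eqP; rewrite -subr_eq0 opprK; apply/eqP; rewrite -h; ring.
Qed.

Lemma circ_pm x y z : x != y -> x != z -> y != z -> c x y z = 1 \/ c x y z = -1.
Proof.
move=> xy xz yz; have := circ_val c_circ x y z.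
rewrite !inE => /or3P[/eqP/(circ_eq0 c_circ)|/eqP->|/eqP->]; [|by left|by right].
by case=> /eqP; [rewrite (negbTE xy)|rewrite (negbTE xz)|rewrite (negbTE yz)].
Qed.

(** The half-open arc from [x] (included) to [y] (excluded); it is empty if
[x = y]. *)
Definition arc x y w : bool := (c x w y == 1) || ((w == x) && (x != y)).

Lemma arcL x y : arc x y x = (x != y).
Proof. by rewrite /arc circ12 eqxx. Qed.

Lemma arcR x y : arc x y y = false.
Proof. by rewrite /arc circ23 /= eq_sym; case: eqP. Qed.

Lemma arc_xx x w : arc x x w = false.
Proof. by rewrite /arc circ13 eqxx andbF. Qed.

Lemma arc_neq x y w : w != x -> arc x y w = (c x w y == 1).
Proof. by rewrite /arc => /negbTE ->; rewrite orbF. Qed.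

(** As [w] varies, the two sides count the arcs that contain it: going from [x] to
[y] and on to [z] covers the arc from [x] to [z], and possibly the whole circle once
more. *)
Lemma arc_add x y z w :
  (arc x y w + arc y z w = arc x z w + ((y != z) && ~~ arc x z y))%N.
Proof.
have [->|wy] := eqVneq w y.
  rewrite arcR arcL; case: eqVneq => [->|yz] /=; first by rewrite arcR.
  by case: (arc x z y).
have [<-|yz] := eqVneq y z; first by rewrite arc_xx addn0.
have [E|xy] := eqVneq x y.
  by subst y; rewrite arc_xx arcL yz addn0.
have [E|xz] := eqVneq x z.
  subst z; rewrite !arc_xx add0n; have [->|wx] := eqVneq w x.
    by rewrite arcL arcR xy.
  rewrite (arc_neq _ wx) (arc_neq _ wy) (circ_swap12 w y x) (circ_swap23 w x y).
  rewrite (circ_swap12 x w y) !opprK /=.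
  by rewrite eq_sym in wx; have [->|->] := circ_pm wx xy wy.
have [E|wx] := eqVneq w x.
  subst w; rewrite !arcL xy xz (arc_neq _ xy) arc_neq 1?eq_sym // circ_swap12.
  by have [->|->] := circ_pm xy xz yz.
have [E|wz] := eqVneq w z.
  subst w; rewrite !arcR addn0 add0n /= !arc_neq 1?eq_sym // circ_swap23.
  by have [->|->] := circ_pm xy xz yz.
rewrite !arc_neq 1?[y == x]eq_sym //.
have := circ_cocycle c_circ x y w z; rewrite (circ_swap23 x w y).
have [->|->] := circ_pm xy xz yz;
have xw : x != w by rewrite eq_sym.
all: have yw : y != w by rewrite eq_sym.
all: have [->|->] := circ_pm xw xy wy; have [->|->] := circ_pm yw yz wz;
  have [->|->] := circ_pm xw xz wz => //.
Qed.

Lemma arc_equiv (f : X -> X) : injective f -> circ_preserving c c f ->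
  forall x y w, arc (f x) (f y) (f w) = arc x y w.
Proof. by move=> fi fc x y w; rewrite /arc fc !(inj_eq fi). Qed.

Section ArcLength.
Context {R : realType} (l : X -> R).
Hypothesis l_gt0 : forall x, 0 < l x.
Hypothesis l_bounded : tbounded l.
Hypothesis l_sum : tsum l = 1.

(** The total length of the half-open arc from [x] to [y]. *)
Definition arclen x y : R := tsum (fun w => (arc x y w)%:R * l w).

Let arc_bounded x y : tbounded (fun w => (arc x y w)%:R * l w).
Proof. exact: tbounded_mask. Qed.

Lemma arclen_add x y z :
  arclen x y + arclen y z = arclen x z + ((y != z) && ~~ arc x z y)%:R.
Proof.
set e := (_ && _).
have he : tsum (fun w => e%:R * l w) = e%:R by rewrite tsumZ // l_sum mulr1.
rewrite -he /arclen -!tsumD //; last exact: (tbounded_mask (fun=> e)).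
apply: eq_tsum => w; rewrite -!mulrDl -!natrD; congr (_%:R * _).
exact: arc_add.
Qed.

Lemma arclen_ge x y : x != y -> l x <= arclen x y.
Proof. by move=> xy; have := tsum_ge1 x (arc_bounded x y); rewrite arcL xy mul1r. Qed.

Lemma arclen_le x y : arclen x y <= 1 - l y.
Proof.
rewrite lerBrDr -[leRHS]l_sum -[l y](tsum_mask1 y l_bounded) /arclen -tsumD //.
  apply: ler_tsum => // w; have [->|wy] := eqVneq w y.
    by rewrite arcR mul0r add0r mul1r lexx ltW.
  rewrite mul0r addr0; case: (arc x y w); rewrite ?mul1r ?mul0r lexx ?andbT ltW //.
exact: (tbounded_mask (pred1 y)).
Qed.

Lemma arclen_bij (f f' : X -> X) x y : cancel f f' -> cancel f' f ->
  circ_preserving c c f ->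
  tsum (fun w => (arc x y w)%:R * l (f w)) = arclen (f x) (f y).
Proof.
move=> fK f'K fc; rewrite /arclen -[RHS](tsum_bij fK f'K) //.
by apply: eq_tsum => w /=; rewrite arc_equiv //; exact: can_inj fK.
Qed.

Variable x0 : X.

(** Cutting the circle at [x0] turns the circular order into the order of the
arc lengths from [x0]. *)
Lemma arclen_lt x y : (arclen x0 y < arclen x0 x) = arc x0 x y.
Proof.
have := arclen_add x0 y x; have [h|h] := boolP (arc x0 x y).
  have yx : y != x by apply: contraTneq h => ->; rewrite arcR.
  have := arclen_ge yx; have := l_gt0 y.
  by rewrite andbF addr0 => h1 h2 h3; apply/idP; lra.
have [->|yx] := eqVneq y x; first by rewrite ltxx.
have := arclen_le y x; have := l_gt0 x.
by rewrite /= => h1 h2 h3; apply/negP; lra.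
Qed.

Lemma arclen_inj : injective (arclen x0).
Proof.
move=> x y E; have [//|xy] := eqVneq x y.
have h1 := arclen_lt x y; have h2 := arclen_lt y x.
rewrite E ltxx in h1; rewrite E ltxx in h2.
have := arclen_add x0 y x; rewrite (eq_sym y x) xy (esym h1) E /=.
have := arclen_le y x; have := l_gt0 x; rewrite mulr1n => ? ? ?; exfalso; lra.
Qed.

Lemma arclenE x : arclen x0 x = tsum (fun y => (arclen x0 y < arclen x0 x)%R%:R * l y).
Proof. by apply: eq_tsum => y; rewrite arclen_lt. Qed.

End ArcLength.

End CircularOrder.

(** * The circle *)

Section Circle.
Context {R : realType}.
Implicit Types (t : R) (z : circle R).

Lemma circle_projP t t' : circle_proj t = circle_proj t' <-> t - t' \is a Num.int.
Proof.
have := Quotient.idealrBE (integers R) t t'; rewrite -[_ \in _]/(_ \is a Num.int).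
by move=> E; rewrite E; split => /eqP.
Qed.

Lemma circle_projDz t (m : int) : circle_proj (t + m%:~R) = circle_proj t.
Proof. by apply/circle_projP; rewrite (addrC t) addrK intr_int. Qed.

Lemma circle_proj_repr z : circle_proj (repr z) = z.
Proof. exact: reprK. Qed.

(** The circle map with lift [F]; it is meaningful if [F] commutes with integer
translations. *)
Definition circle_map (F : R -> R) z : circle R := circle_proj (F (repr z)).

Lemma circle_mapE F t : (forall s (m : int), F (s + m%:~R) = F s + m%:~R) ->
  circle_map F (circle_proj t) = circle_proj (F t).
Proof.
move=> FD; have /circle_projP/intrP[m hm] := circle_proj_repr (circle_proj t).
have -> : t = repr (circle_proj t) + (- m)%:~R by rewrite mulrNz -hm; ring.
rewrite FD circle_projDz /circle_map.
by rewrite circle_projDz !circle_proj_repr.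
Qed.

Lemma circle_positive_neq (x y z : circle R) : circle_positive x y z ->
  [/\ x <> y, x <> z & y <> z].
Proof.
move=> [a [b [c [<- <- <- [ab bc ca]]]]].
have H (s t : R) : s < t -> t < s + 1 -> circle_proj s <> circle_proj t.
  move=> st ts /circle_projP/intrP[m hm].
  have h1 : -1 < m%:~R :> R by rewrite -hm; lra.
  have h2 : m%:~R < 0 :> R by rewrite -hm; lra.
  move: h1 h2; rewrite -[-1]/((-1)%:~R) -[0]/(0%:~R) !ltr_int; lia.
by split; apply: H; lra.
Qed.

Lemma circle_positive_asym (x y z : circle R) :
  circle_positive x y z -> ~ circle_positive x z y.
Proof.
move=> [a [b [c [<- <- <- [ab bc ca]]]]].
move=> [a' [c' [b' [/circle_projP/intrP[m hm] /circle_projP/intrP[k hk]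
  /circle_projP/intrP[j hj] [ac' cb' ba']]]]].
have h1 : (k - m)%:~R < 1 :> R by rewrite intrD mulrNz -hk -hm; lra.
have h2 : -1 < (k - m)%:~R :> R by rewrite intrD mulrNz -hk -hm; lra.
have h3 : (j - m)%:~R < 1 :> R by rewrite intrD mulrNz -hj -hm; lra.
have h4 : -1 < (j - m)%:~R :> R by rewrite intrD mulrNz -hj -hm; lra.
have km : k = m.
  move: h1 h2; rewrite -[-1]/((-1)%:~R) -[1]/(1%:~R) !ltr_int; lia.
have jm : j = m.
  move: h3 h4; rewrite -[-1]/((-1)%:~R) -[1]/(1%:~R) !ltr_int; lia.
subst k j; lra.
Qed.

End Circle.

(** * Maps of the interval *)

Section Interval.
Context {R : realType}.
Implicit Types (x y : unit_interval R) (F : R -> R).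

Lemma unit_intervalP x : 0 <= \val x <= 1.
Proof. by have := valP x; rewrite inE /= in_itv. Qed.

Lemma unit_interval_ex (t : R) : 0 <= t <= 1 -> exists x : unit_interval R, \val x = t.
Proof.
move=> t01; have tI : t \in `[0 : R, 1]%classic by rewrite inE /= in_itv.
by exists (exist _ t tI).
Qed.

(** The restriction to the unit interval of a map [F] that preserves it; points
that leave the interval are left fixed. *)
Definition interval_map F x : unit_interval R := insubd x (F (\val x)).

Lemma interval_mapE F x : 0 <= F (\val x) <= 1 -> \val (interval_map F x) = F (\val x).
Proof. by move=> h; rewrite insubdK // inE /= in_itv. Qed.

Lemma continuous_unit_val : continuous (fun x : unit_interval R => \val x).
Proof. exact: initial_continuous. Qed.

Lemma interval_map_C1 F (dF : R -> R) :
  (forall x, 0 <= F (\val x) <= 1) ->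
  (forall t : R, is_derive t 1 F (dF t)) -> continuous dF ->
  C1_interval (interval_map F).
Proof.
move=> F01 hF cF; exists (fun x => dF (\val x)); split.
  move=> x; apply: continuous_comp; [exact: continuous_unit_val|exact: cF].
move=> x; apply/cvgrPdist_le => e e0.
have /is_derive_eps/(_ _ e0)[r r0 hr] := hF (\val x).
have /cvgrPdist_lt/(_ _ r0) h := @continuous_unit_val x.
change (nbhs x (fun y => y != x -> `|dF (\val x) -
  (\val (interval_map F y) - \val (interval_map F x)) / (\val y - \val x)| <= e)).
apply: filterS h => y; rewrite distrC => /hr h yx; move: h.
rewrite !interval_mapE //.
have d0 : \val y - \val x != 0 by rewrite subr_eq0; apply: contra yx => /eqP/val_inj ->.
have n0 : 0 < `|\val y - \val x| by rewrite normr_gt0.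
move=> h1; rewrite -(ler_pM2r n0) -normrM; apply: le_trans h1.
by rewrite mulrBl divfK // distrC.
Qed.

End Interval.

(** * The two realisation theorems *)

Lemma normalised_length (R : realType) (G : groupType) (X : choiceType)
    (a : G -> X -> X) (x0 : X) :
  countable [set: G] -> countable [set: X] ->
  (forall H : set G, is_subgroup H -> finitely_generated H ->
       ~ exponential_growth R H) ->
  is_left_action a ->
  exists l : X -> R, [/\ forall x, 0 < l x, tbounded l, tsum l = 1 &
    forall g (e : R), 0 < e -> exists E : {fset X},
      forall x, x \notin E -> l (a g x) <= (1 + e) * l x].
Proof.
move=> Gc Xc Gg act.
have [l [l0 lb lE]] := almost_invariant_length Gc Xc Gg act.
have T0 : 0 < tsum l by apply: lt_le_trans (l0 x0) _; exact: tsum_ge1.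
have [_ [M lM]] := lb.
have Ti : 0 <= (tsum l)^-1 by rewrite invr_ge0 ltW.
exists (fun x => (tsum l)^-1 * l x); split.
- by move=> x; rewrite mulr_gt0 // invr_gt0.
- split=> [x|]; first by rewrite mulr_ge0 // ltW.
  by exists ((tsum l)^-1 * M) => E; rewrite -mulr_sumr ler_wpM2l.
- by rewrite tsumZ // mulVf // gt_eqF.
- move=> g e /(lE g)[E hE]; exists E => x /hE h.
  by rewrite mulrCA ler_wpM2l.
Qed.

(** With [c g = 0], all the lifts fix [0] and [1], and the integers by which they
fail to compose vanish. *)
Theorem linear_realisation (R : realType) (G : groupType) (d : Order.disp_t)
    (X : orderType d) (a : G -> X -> X) :
  countable [set: G] ->
  (forall H : set G, is_subgroup H -> finitely_generated H ->
       ~ exponential_growth R H) ->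
  countable [set: X] -> is_left_action a ->
  (forall g, {homo a g : x y / (x <= y)%O}) ->
  exists (b : G -> unit_interval R -> unit_interval R) (i : X -> unit_interval R),
    [/\ is_left_action b,
        forall g, C1_diffeo (@C1_interval R) (b g),
        forall g x, i (a g x) = b g (i x),
        injective i
      & {homo i : x y / (x <= y)%O >-> \val x <= \val y}].
Proof.
move=> Gc Gg Xc act a_mono.
have [[x0 _]|nX] := pselect (exists x : X, True); last first.
  (* If X is empty, let G act trivially. *)
  have idC1 : C1_interval (fun x : unit_interval R => x).
    have : C1_interval (interval_map (fun t : R => t)).
      apply: (@interval_map_C1 _ _ (fun=> 1)).
      - exact: unit_intervalP.
      - by move=> t; exact: cvg_cst.
    congr C1_interval; apply/funext => x; apply: val_inj.
    by rewrite interval_mapE // unit_intervalP.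
  have abs (x : X) : False by apply: nX; exists x.
  exists (fun _ x => x), (fun x => False_rect _ (abs x)).
  split=> //; [|by move=> g x; case: (abs x)..].
  by move=> g; exists (fun x => x); split.
have [l [l0 lb l1 lE]] := normalised_length x0 Gc Xc Gg act.
have [a1 aM] := act.
have aK g : cancel (a g) (a (g^-1)%g) by move=> x; rewrite -aM mulVg a1.
have aVK g : cancel (a (g^-1)%g) (a g) by move=> x; rewrite -aM mulgV a1.
have a_lt g x y : (a g x < a g y)%O = (x < y)%O.
  apply/idP/idP; rewrite !ltNge; apply: contra; first exact: a_mono.
  by move=> /(a_mono (g^-1)%g); rewrite !aK.
pose p x : R := tsum (fun y => (y < x)%O%:R * l y).
have pb x : tbounded (fun y => (y < x)%O%:R * l y).
  exact: (tbounded_mask (fun y => (y < x)%O)).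
have p_sep x y : (x < y)%O -> p x < p y.
  move=> xy; apply: (@lt_le_trans _ _ (p x + l x)); first by rewrite ltrDl.
  rewrite /p -[l x](tsum_mask1 x lb) -tsumD //; last exact: (tbounded_mask (pred1 x)).
  apply: ler_tsum => // z; have [->|zx] := eqVneq z x.
    by rewrite ltxx xy mul0r add0r !mul1r lexx andbT ltW.
  rewrite mul0r addr0; have [zx'|_] := boolP (z < x)%O.
    by rewrite (lt_trans zx' xy) mul1r lexx andbT ltW.
  by rewrite mul0r lexx mulr_ge0 // ltW.
have p_lt x y : (p x < p y) = (x < y)%O.
  apply/idP/idP; last exact: p_sep.
  rewrite [(x < y)%O]ltNge; apply: contraTN; rewrite le_eqVlt -leNgt.
  by move=> /predU1P[->//|/p_sep/ltW].
have p_inj : injective p.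
  move=> x y E; have := p_lt x y; have := p_lt y x; rewrite E ltxx.
  by have [h|h|//] := ltgtP x y.
have pE x : p x = tsum (fun y => (p y < p x)%R%:R * l y).
  by apply: eq_tsum => y; rewrite p_lt.
have c_int g x : 0 + tsum (fun y => (p y < p x)%R%:R * l (a g y)) - p (a g x) \is a Num.int.
  rewrite add0r (_ : tsum _ = p (a g x)) ?subrr ?rpred0 //.
  rewrite /p -[RHS](tsum_bij (aK g) (aVK g)) //.
  by apply: eq_tsum => y /=; rewrite p_lt a_lt.
pose F := lift l p a (fun=> 0).
have F0 g : F g 0 = 0 by rewrite /F (lift0 _ l0 lb l1 pE act).
have F1 g : F g 1 = 1.
  have := liftDz l p a (fun=> 0) g 0 1; rewrite add0r -/F F0 add0r; exact.
have F_mono g : {homo F g : s t / s < t}.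
  exact: (lift_mono (fun=> 0) l0 lb l1 p_inj pE act lE).
have F_le g : {homo F g : s t / s <= t}.
  by move=> s t; rewrite le_eqVlt => /predU1P[->//|/F_mono/ltW]; apply.
have F01 g t : 0 <= t <= 1 -> 0 <= F g t <= 1.
  move=> /andP[t0 t1]; rewrite -{1}(F0 g) F_le //=.
  by rewrite -(F1 g) F_le.
have F_comp g h t : F g (F h t) = F (g * h)%g t.
  have [m hm] := lift_comp x0 l0 lb l1 p_inj pE act lE c_int g h.
  have := hm 0; rewrite -/F !F0 add0r => m0.
  by rewrite /F hm -m0 addr0.
have F_1 t : F 1%g t = t.
  have [m hm] := lift_1 x0 l0 lb l1 p_inj pE act lE c_int.
  have := hm 0; rewrite -/F F0 add0r => m0.
  by rewrite /F hm -m0 addr0.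
have p01 x : 0 <= p x <= 1.
  by rewrite (position_ge0 lb pE) /=; have := position_le1 l0 lb l1 pE x; have := l0 x; lra.
have F_point g x : F g (p x) = p (a g x).
  have /intrP[m hm] := lift_point l0 lb l1 p_inj pE act c_int g x.
  have /andP[f0 f1] := F01 g _ (p01 x); have /andP[q0 q1] := p01 (a g x).
  have px1 : p x < 1 by have := position_le1 l0 lb l1 pE x; have := l0 x; lra.
  have qx1 : p (a g x) < 1 by have := position_le1 l0 lb l1 pE (a g x); have := l0 (a g x); lra.
  have fx1 : F g (p x) < 1 by rewrite -(F1 g) F_mono.
  have h1 : -1 < m%:~R :> R by rewrite -hm -/F; lra.
  have h2 : m%:~R < 1 :> R by rewrite -hm -/F; lra.
  have m0 : m = 0.
    by move: h1 h2; rewrite -[-1]/((-1)%:~R) -[1]/(1%:~R) !ltr_int; lia.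
  by apply/eqP; rewrite -subr_eq0 /F hm m0.
pose b g := interval_map (F g).
have bE g x : \val (b g x) = F g (\val x).
  by rewrite interval_mapE // F01 // unit_intervalP.
have [i iE] := choice (fun x => unit_interval_ex (p01 x)).
have b1 x : b 1%g x = x by apply: val_inj; rewrite bE F_1.
have bM g h x : b (g * h)%g x = b g (b h x).
  by apply: val_inj; rewrite !bE F_comp.
have bC1 g : C1_interval (b g).
  apply: interval_map_C1; first by move=> x; rewrite F01 // unit_intervalP.
    exact: (lift_derivP (fun=> 0) l0 lb l1 p_inj pE act lE).
  exact: (lift_deriv_continuous l0 lb l1 p_inj pE act lE).
exists b, i; split.
- by split.
- move=> g; exists (b (g^-1)%g); split => //.
  + by move=> x; rewrite -bM mulVg b1.
  + by move=> x; rewrite -bM mulgV b1.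
- by move=> g x; apply: val_inj; rewrite bE !iE F_point.
- by move=> x y /(congr1 \val); rewrite !iE => /p_inj.
- by move=> x y xy; rewrite !iE leNgt p_lt -leNgt.
Qed.

Lemma circle_map_C1 (R : realType) (F dF : R -> R) :
  (forall s (m : int), F (s + m%:~R) = F s + m%:~R) ->
  (forall t : R, is_derive t 1 F (dF t)) -> continuous dF ->
  C1_circle (circle_map F).
Proof.
move=> FD hF cF x; exists F; apply/nbhs_eps; exists 1 => // t _; split.
- by rewrite circle_mapE.
- by have [] := hF t.
- rewrite (_ : derive1 F = dF); first exact: cF.
  by apply/funext => s; rewrite derive1E; have [_ ->] := hF s.
Qed.

(** The points are placed on the circle by their arc lengths from a base point
[x0]. *)
Theorem circular_realisation (R : realType) (G : groupType) (X : choiceType)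
    (c : X -> X -> X -> int) (a : G -> X -> X) :
  countable [set: G] ->
  (forall H : set G, is_subgroup H -> finitely_generated H ->
       ~ exponential_growth R H) ->
  countable [set: X] -> is_circular_order c -> is_left_action a ->
  (forall g, circ_preserving c c (a g)) ->
  exists (b : G -> circle R -> circle R) (i : X -> circle R),
    [/\ is_left_action b,
        forall g, C1_diffeo (@C1_circle R) (b g),
        forall g x, i (a g x) = b g (i x),
        injective i
      & circ_preserving c (@circle_order R) i].
Proof.
move=> Gc Gg Xc cc act a_circ.
have [[x0 _]|nX] := pselect (exists x : X, True); last first.
  (* If X is empty, let G act trivially. *)
  have idC1 : C1_circle (fun z : circle R => z).
    have : C1_circle (circle_map (fun t : R => t)).
      apply: (@circle_map_C1 _ _ (fun=> 1)) => //.
      by move=> t; exact: cvg_cst.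
    congr C1_circle; apply/funext => z; exact: circle_proj_repr.
  have abs (x : X) : False by apply: nX; exists x.
  exists (fun _ x => x), (fun x => False_rect _ (abs x)).
  split=> //; [|by move=> g x; case: (abs x)..].
  by move=> g; exists (fun x => x); split.
have [l [l0 lb l1 lE]] := normalised_length x0 Gc Xc Gg act.
have [a1 aM] := act.
have aK g : cancel (a g) (a (g^-1)%g) by move=> x; rewrite -aM mulVg a1.
have aVK g : cancel (a (g^-1)%g) (a g) by move=> x; rewrite -aM mulgV a1.
pose A := arclen c l.
pose p x : R := A x0 x.
have p_inj : injective p by exact: (arclen_inj cc l0 lb l1).
have pE x : p x = tsum (fun y => (p y < p x)%R%:R * l y).
  exact: (arclenE cc l0 lb l1).
pose cst g : R := p (a g x0).
have c_int g x : cst g + tsum (fun y => (p y < p x)%R%:R * l (a g y)) - p (a g x) \is a Num.int.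
  have -> : tsum (fun y => (p y < p x)%R%:R * l (a g y)) = A (a g x0) (a g x).
    rewrite /A -(arclen_bij lb x0 x (aK g) (aVK g) (a_circ g)).
    by apply: eq_tsum => y; rewrite (arclen_lt cc l0 lb l1).
  rewrite /cst /p /A (arclen_add cc lb l1) addrC addKr.
  by rewrite natr_int.
pose F := lift l p a cst.
have FD g t (m : int) : F g (t + m%:~R) = F g t + m%:~R by exact: liftDz.
pose b g := circle_map (F g).
have bE g t : b g (circle_proj t) = circle_proj (F g t) by exact: circle_mapE.
have b1 z : b 1%g z = z.
  rewrite -(circle_proj_repr z) bE.
  have [m hm] := lift_1 x0 l0 lb l1 p_inj pE act lE c_int.
  by rewrite /F hm circle_projDz.
have bM g h z : b (g * h)%g z = b g (b h z).
  rewrite -(circle_proj_repr z) !bE.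
  have [m hm] := lift_comp x0 l0 lb l1 p_inj pE act lE c_int g h.
  by rewrite /F hm circle_projDz.
have bC1 g : C1_circle (b g).
  apply: circle_map_C1; first exact: FD.
    exact: (lift_derivP cst l0 lb l1 p_inj pE act lE).
  exact: (lift_deriv_continuous l0 lb l1 p_inj pE act lE).
pose i x := circle_proj (p x).
have i_pos x y z : c x y z = 1 -> circle_positive (i x) (i y) (i z).
  move=> h.
  have xy : x != y by apply: contra_eq_neq h => ->; rewrite (circ12 cc).
  have xz : x != z by apply: contra_eq_neq h => ->; rewrite (circ13 cc).
  have yz : y != z by apply: contra_eq_neq h => ->; rewrite (circ23 cc).
  have hA : A x y + A y z = A x z.
    by rewrite /A (arclen_add cc lb l1) yz /arc h eqxx /= addr0.
  have lift_arc u v : circle_proj (p u + A u v) = i v.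
    apply/circle_projP; rewrite /p /A (arclen_add cc lb l1).
    by rewrite (addrC (arclen _ _ _ _)) addrK natr_int.
  exists (p x), (p x + A x y), (p x + A x z); split=> //.
  have := arclen_ge cc lb xy; have := arclen_ge cc lb yz.
  have := arclen_le cc l0 lb l1 x z; rewrite -/A => h1 h2 h3.
  have := l0 x; have := l0 y; have := l0 z; clear xy yz xz => *.
  by split; lra.
have i_circ : circ_preserving c (@circle_order R) i.
  move=> x y z; rewrite /circle_order.
  have := circ_val cc x y z; rewrite !inE => /or3P[] /eqP h; rewrite h.
  - rewrite !asboolF //; move=> /circle_positive_neq[h1 h2 h3];
      by move/(circ_eq0 cc): h => -[] E; subst.
  - by rewrite asboolT //; exact: i_pos.
  - have h' : c x z y = 1 by rewrite (circ_swap23 cc) h opprK.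
    rewrite asboolF; last exact: circle_positive_asym (i_pos _ _ _ h').
    by rewrite asboolT //; exact: i_pos.
exists b, i; split=> //.
- move=> g; exists (b (g^-1)%g); split => //.
  + by move=> x; rewrite -bM mulVg b1.
  + by move=> x; rewrite -bM mulgV b1.
- move=> g x; rewrite /i bE; apply/esym/circle_projP.
  exact: (lift_point l0 lb l1 p_inj pE act c_int).
- move=> x y /circle_projP/intrP[m hm]; apply: p_inj.
  have := position_le1 l0 lb l1 pE x; have := position_le1 l0 lb l1 pE y.
  have := position_ge0 lb pE x; have := position_ge0 lb pE y; have := l0 x; have := l0 y.
  move=> *.
  have h1 : -1 < m%:~R :> R by rewrite -hm; lra.
  have h2 : m%:~R < 1 :> R by rewrite -hm; lra.
  have m0 : m = 0.
    by move: h1 h2; rewrite -[-1]/((-1)%:~R) -[1]/(1%:~R) !ltr_int; lia.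
  by apply/eqP; rewrite -subr_eq0 hm m0.
Qed.

Theorem theorem1p1 (R : realType) (G : groupType)
    (G_countable : countable [set: G])
    (G_growth : forall H : set G, is_subgroup H -> finitely_generated H ->
       ~ exponential_growth R H) :
  (forall (d : Order.disp_t) (X : orderType d) (a : G -> X -> X),
     countable [set: X] ->
     is_left_action a ->
     (forall g, {homo a g : x y / (x <= y)%O}) ->
     exists (b : G -> unit_interval R -> unit_interval R)
            (i : X -> unit_interval R),
       [/\ is_left_action b,
           forall g, C1_diffeo (@C1_interval R) (b g),
           forall g x, i (a g x) = b g (i x),
           injective i
         & {homo i : x y / (x <= y)%O >-> \val x <= \val y}])
  /\
  (forall (X : Type) (c : X -> X -> X -> int) (a : G -> X -> X),
     countable [set: X] ->
     is_circular_order c ->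
     is_left_action a ->
     (forall g, circ_preserving c c (a g)) ->
     exists (b : G -> circle R -> circle R) (i : X -> circle R),
       [/\ is_left_action b,
           forall g, C1_diffeo (@C1_circle R) (b g),
           forall g x, i (a g x) = b g (i x),
           injective i
         & circ_preserving c (@circle_order R) i]).
Proof.
split=> [d X a Xc act a_mono|X c a Xc cc act a_circ].
  exact: linear_realisation.
(* Choice on X, which is a bare type, comes from classical logic. *)
exact: (@circular_realisation R G {classic X} c a).
Qed.
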